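(* Let $k\in\mathbb{N}$, $r\in\mathbb{N}_0$, and let $\mathsf f=\{f_1,\dots,f_k\}$ and $\mathsf g=\{g_0=1,g_1,\dots,g_r\}$ be subsets of $\mathbb{R}[x_1,\dots,x_d]$ such that the polynomials $f_1,\dots,f_k$ are linear (i.e. of degree at most one). Suppose that the polyhedron $\mathcal{K}(\mathsf f)$ is compact and nonempty. (i) If $h\in\mathbb{R}[x_1,\dots,x_d]$ satisfies $h(x)>0$ for all $x\in\mathcal{K}(\mathsf f)\cap\mathcal{K}(\mathsf g)$, then $h\in C(\mathsf f,\mathsf g)$, that is, $h$ is a finite sum of polynomials $\alpha\, g_j\, f_1^{n_1}\cdots f_k^{n_k}$, where $\alpha\ge0$, $j\in\{0,\dots,r\}$, and $n_1,\dots,n_k\in\mathbb{N}_0$. (ii) A linear functional $L$ on $\mathbb{R}[x_1,\dots,x_d]$ is a $\mathcal{K}(\mathsf f)\cap\mathcal{K}(\mathsf g)$-moment functional if and only if $L(g_j f_1^{n_1}\cdots f_k^{n_k})\ge0$ for all $j=0,\dots,r$ and all $n_1,\dots,n_k\in\mathbb{N}_0$.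
   Context: For a finite set $\mathsf p=\{p_1,\dots,p_m\}$ of polynomials, $\mathcal{K}(\mathsf p)=\{x\in\mathbb{R}^d: p_1(x)\ge0,\dots,p_m(x)\ge0\}$. $S(\mathsf f)$ is the set of all finite sums of terms $\alpha f_1^{n_1}\cdots f_k^{n_k}$ with $\alpha\ge0$ real and $n_1,\dots,n_k\in\mathbb{N}_0$, and $C(\mathsf f,\mathsf g)=g_0S(\mathsf f)+g_1S(\mathsf f)+\cdots+g_rS(\mathsf f)$. For a closed set $K\subseteq\mathbb{R}^d$, a linear functional $L$ on $\mathbb{R}[x_1,\dots,x_d]$ is a $K$-moment functional if there is a (positive) Radon measure $\mu$ supported on $K$ such that every polynomial is $\mu$-integrable and $L(p)=\int p\,d\mu$ for all polynomials $p$. *)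

(* Defs.v *)
From HB Require Import structures.
From mathcomp Require Import all_boot all_order all_algebra.
From mathcomp Require Import all_classical all_reals all_analysis.
(* Importing the notations of mpoly clashes with those of mathcomp-analysis. *)
From mathcomp Require Import -(notations) mpoly.
Set Implicit Arguments.
Unset Strict Implicit.
Unset Printing Implicit Defensive.
Import Order.TTheory GRing.Theory Num.Theory.
Import numFieldNormedType.Exports.
Local Open Scope classical_set_scope.
Local Open Scope ring_scope.

Section Polynomials.
Context {R : realType} {d : nat}.

Definition peval (p : mpoly d R) (x : 'rV[R]_d) : R :=
  meval (fun i => x ord0 i) p.

(* msize is the total degree plus one, and 0 for the zero polynomial. *)
Definition degree_le1 (p : mpoly d R) : Prop := (msize p <= 2)%N.

Definition semialg {m : nat} (p : 'I_m -> mpoly d R) : set 'rV[R]_d :=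
  [set x | forall i, 0 <= peval (p i) x].

Definition pprod {k : nat} (f : 'I_k -> mpoly d R) (n : 'I_k -> nat) :
  mpoly d R := \prod_(i < k) f i ^+ n i.

Definition semiringS {k : nat} (f : 'I_k -> mpoly d R) : set (mpoly d R) :=
  [set p | exists (N : nat) (a : 'I_N -> R) (n : 'I_N -> 'I_k -> nat),
     (forall t, 0 <= a t) /\ p = \sum_(t < N) a t *: pprod f (n t)].

Definition moduleC {k m : nat} (f : 'I_k -> mpoly d R)
    (g : 'I_m -> mpoly d R) : set (mpoly d R) :=
  [set p | exists s : 'I_m -> mpoly d R,
     (forall j, semiringS f (s j)) /\ p = \sum_(j < m) g j * s j].

End Polynomials.

Notation borelRd R d := (g_sigma_algebraType (@open 'rV[R]_d)).

Section Moments.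
Context {R : realType} {d : nat}.

Definition radon (mu : {measure set (borelRd R d) -> \bar R}) : Prop :=
  (forall A : set 'rV[R]_d, compact A -> (mu A < +oo)%E) /\
  (forall B : set (borelRd R d), measurable B ->
     mu B = ereal_sup
       [set mu A | A in [set A : set 'rV[R]_d | compact A /\ A `<=` B]]).

(* The measure is on all of R^d; for closed K, [supp mu] lies in K exactly
   when the complement of K is a null set. *)
Definition moment_functional (K : set 'rV[R]_d)
    (L : {scalar mpoly d R}) : Prop :=
  exists mu : {measure set (borelRd R d) -> \bar R},
    [/\ radon mu,
        mu (~` K) = 0%E,
        forall p : mpoly d R,
          mu.-integrable [set: borelRd R d] (fun x => (peval p x)%:E) &
        forall p : mpoly d R,
          (L p)%:E = (\int[mu]_(x in [set: borelRd R d]) (peval p x)%:E)%E].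

End Moments.

(* Main.v *)
Require Import Defs.
From HB Require Import structures.
From mathcomp Require Import all_boot all_order all_algebra.
From mathcomp Require Import all_classical all_reals all_analysis.
From mathcomp Require Import -(notations) mpoly.
From mathcomp Require Import measurable_realfun.
From mathcomp Require Import ring lra.
Set Implicit Arguments.
Unset Strict Implicit.
Unset Printing Implicit Defensive.
Import Order.TTheory GRing.Theory Num.Theory.
Import numFieldNormedType.Exports.
Local Open Scope classical_set_scope.
Local Open Scope ring_scope.

(** Write K for the set where all f i and all g j are nonnegative.

    Part (i). The polyhedron of the f i is nonempty and lies in a cube
    [-c, c]^d, so by Farkas' lemma the affine forms c + x_i and c - x_i are
    nonnegative combinations of 1 and the f i [affine_nonneg_semiringS]. The
    products of these forms contain the Bernstein basis of the cube, and the
    Bernstein coefficients of a polynomial converge uniformly to its values at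
    the grid points [cube_bernP]; a polynomial that is positive on the cube
    therefore has nonnegative coefficients in high degree and belongs to the
    semiring of the f i [cube_pos_semiringS]. To go from a compact set X to the
    subset where some polynomials q <= 1 are nonnegative, subtract the sum of
    the q (1 - q) ^ n: these terms are at most 1 / (n + 1) everywhere, and tend
    to minus infinity where q is negative. So a polynomial that is positive on
    the subset becomes positive on all of X when n is large
    [positive_perturbation]. This is applied twice, from the cube to the
    polyhedron with the f i [pos_semiringS], then from the polyhedron to K with
    the g j [pos_moduleC]; each time the factor 1 - q is already known to lie
    in the semiring.

    Part (ii). If L is represented by a measure on K, it is nonnegative on the
    generators because they are nonnegative on K. Conversely, by part (i), L is
    nonnegative on every polynomial that is nonnegative on K. The values of L on
    the Bernstein basis of degree n are nonnegative weights at the grid points,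
    and the weighted sums of p over the grid tend to L p [bern_sum_cvg]. The
    representing measure is a limit of these grid masses. The cube is bisected
    again and again, and each box is given the limit of its grid masses along an
    ultrafilter [exists_limit_mass]; these limits are finitely additive. They are
    laid out as nested intervals on the line, the length of an interval being
    the mass of its box, and a number is sent to the point of the cube singled
    out by the intervals that contain it. The image of Lebesgue measure under
    this map represents L on the cube [moment_functional_cube], and it is a Radon
    measure by Lusin's theorem. Finally, the polynomials q (1 - q) ^ n show once
    more that the sets where some f i or g j is negative carry no mass
    [sublevel_null]. *)

(** * The semiring generated by the f i *)

Section SemiringS.
Context {R : realType} {d k : nat} (f : 'I_k -> mpoly d R).

Lemma pprodD (n1 n2 : 'I_k -> nat) :
  pprod f n1 * pprod f n2 = pprod f (fun i => n1 i + n2 i)%N.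
Proof. by rewrite /pprod -big_split; apply: eq_bigr => i _; rewrite exprD. Qed.

(** Sums over arbitrary finite types are allowed, so that a sum or a product of
    two elements can be indexed by the disjoint union or the product of their
    index types. *)
Lemma semiringS_fin (I : finType) (a : I -> R) (n : I -> 'I_k -> nat) :
  (forall t, 0 <= a t) -> semiringS f (\sum_t a t *: pprod f (n t)).
Proof.
move=> a0; exists #|I|, (a \o enum_val), (n \o enum_val); split => [t|].
  exact: a0.
rewrite (reindex (@enum_val I predT)) //=.
by exists enum_rank => x _; [exact: enum_valK|exact: enum_rankK].
Qed.

Lemma semiringS_pprod (n : 'I_k -> nat) : semiringS f (pprod f n).
Proof.
rewrite (_ : pprod f n = \sum_(t : unit) 1 *: pprod f n).
  by apply: semiringS_fin => _; exact: ler01.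
by rewrite big_const cardT enumT unlock /= scale1r addr0.
Qed.

Lemma semiringS0 : semiringS f 0.
Proof. by exists 0%N, (fun=> 0), (fun _ _ => 0%N); rewrite big_ord0. Qed.

Lemma semiringS1 : semiringS f 1.
Proof.
rewrite (_ : 1 = pprod f (fun=> 0%N)); first exact: semiringS_pprod.
by rewrite /pprod big1.
Qed.

Lemma semiringS_gen i : semiringS f (f i).
Proof.
rewrite (_ : f i = pprod f (fun j => (j == i) : nat)); first exact: semiringS_pprod.
rewrite /pprod (bigD1 i)//= eqxx expr1 big1 ?mulr1// => j /negbTE ->.
exact: expr0.
Qed.

Lemma semiringSZ c p : 0 <= c -> semiringS f p -> semiringS f (c *: p).
Proof.
move=> c0 [N [a [n [a0 ->]]]]; rewrite scaler_sumr.
under eq_bigr do rewrite scalerA.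
by apply: semiringS_fin => t; rewrite mulr_ge0.
Qed.

Lemma semiringSD p q : semiringS f p -> semiringS f q -> semiringS f (p + q).
Proof.
move=> [N [a [n [a0 ->]]]] [M [b [m [b0 ->]]]].
pose c (t : 'I_N + 'I_M) := match t with inl i => a i | inr j => b j end.
pose l (t : 'I_N + 'I_M) := match t with inl i => n i | inr j => m j end.
rewrite (_ : _ + _ = \sum_t c t *: pprod f (l t)); last by rewrite big_sumType.
by apply: semiringS_fin => -[i|j]; [exact: a0|exact: b0].
Qed.

Lemma semiringSM p q : semiringS f p -> semiringS f q -> semiringS f (p * q).
Proof.
move=> [N [a [n [a0 ->]]]] [M [b [m [b0 ->]]]].
rewrite (_ : _ * _ = \sum_(t : 'I_N * 'I_M)
  (a t.1 * b t.2) *: pprod f (fun i => n t.1 i + m t.2 i)%N).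
  by apply: semiringS_fin => t; rewrite mulr_ge0.
rewrite big_distrlr/= pair_bigA/=; apply: eq_bigr => t _.
by rewrite -scalerAl -scalerAr scalerA pprodD.
Qed.

Lemma semiringS_sum (I : Type) (r : seq I) (P : pred I) (F : I -> mpoly d R) :
  (forall i, P i -> semiringS f (F i)) -> semiringS f (\sum_(i <- r | P i) F i).
Proof. by move=> FS; apply: big_ind => //; [exact: semiringS0|exact: semiringSD]. Qed.

Lemma semiringS_prod (I : Type) (r : seq I) (P : pred I) (F : I -> mpoly d R) :
  (forall i, P i -> semiringS f (F i)) -> semiringS f (\prod_(i <- r | P i) F i).
Proof. by move=> FS; apply: big_ind => //; [exact: semiringS1|exact: semiringSM]. Qed.

Lemma semiringSX p n : semiringS f p -> semiringS f (p ^+ n).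
Proof.
by move=> pS; elim: n => [|n IH]; [exact: semiringS1|rewrite exprS; exact: semiringSM].
Qed.

End SemiringS.

(** * Farkas' lemma *)

Section Farkas.
Context {F : realFieldType} {n : nat}.
Implicit Types (a b g x y : 'rV[F]_n) (s : seq 'rV[F]_n).

Definition dot a x : F := (a *m x^T) ord0 ord0.

Lemma dotE a x : dot a x = \sum_i a ord0 i * x ord0 i.
Proof. by rewrite /dot mxE; apply: eq_bigr => i _; rewrite mxE. Qed.

Lemma dot0l x : dot 0 x = 0.
Proof. by rewrite /dot mul0mx mxE. Qed.

Lemma dotBl a b x : dot (a - b) x = dot a x - dot b x.
Proof. by rewrite /dot mulmxBl !mxE. Qed.

Lemma dotZl c a x : dot (c *: a) x = c * dot a x.
Proof. by rewrite /dot -scalemxAl !mxE. Qed.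

Lemma dotDr a x y : dot a (x + y) = dot a x + dot a y.
Proof. by rewrite /dot linearD /= mulmxDr !mxE. Qed.

Lemma dotBr a x y : dot a (x - y) = dot a x - dot a y.
Proof. by rewrite /dot linearB /= mulmxBr !mxE. Qed.

Lemma dotZr c a x : dot a (c *: x) = c * dot a x.
Proof. by rewrite /dot linearZ /= -scalemxAr !mxE. Qed.

(** The convex cone spanned by the list [s]. Removing the generators one at a
    time suits the induction on [s] in Farkas' lemma. *)
Fixpoint in_cone s g : Prop :=
  if s is a :: s' then exists2 c : F, 0 <= c & in_cone s' (g - c *: a) else g = 0.

(** Undoes the projection along [a] that occurs in Farkas' lemma: all [t b] are
    nonpositive, so what the projection took away adds up to a nonnegative
    multiple of [a]. *)
Lemma in_cone_shift a (t : 'rV[F]_n -> F) s g :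
  (forall b, b \in s -> t b <= 0) ->
  in_cone [seq b - t b *: a | b <- s] g ->
  exists2 c, 0 <= c & in_cone s (g - c *: a).
Proof.
elim: s g => [g _ /= ->|b s IH g tle /= [l l0 gl]].
  by exists 0; rewrite // scale0r subr0.
have [|c c0 gc] := IH _ _ gl.
  by move=> e es; apply: tle; rewrite inE es orbT.
exists (c - l * t b).
  by rewrite subr_ge0 (le_trans _ c0)// mulr_ge0_le0// tle// mem_head.
exists l => //; congr (in_cone s _): gc.
apply/rowP => i; rewrite !mxE; ring.
Qed.

(** Bartl's induction on the number of generators. Let [x] separate [g] from all
    generators but the first one, [a], and suppose that [a] is positive at [x].
    Project every vector [b] to [b - (b x / a x) a], which vanishes at [x].
    If the projected [g] is in the projected cone, it lifts by [in_cone_shift].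
    Otherwise some [y] separates them; corrected by a multiple of [x], it is
    orthogonal to [a] and pairs with each [b] as [y] does with its projection. *)
Lemma farkas s g : in_cone s g \/
  exists x, (forall a, a \in s -> dot a x <= 0) /\ 0 < dot g x.
Proof.
elim: {s}(size s) {-2}s (erefl (size s)) g => [|m IH] [|a s]//= sz g.
  have [->|g0] := eqVneq g 0; [by left|right].
  exists g; split => //.
  rewrite dotE lt_def sumr_ge0 ?andbT; last by move=> i _; rewrite -expr2 sqr_ge0.
  apply: contra g0; rewrite psumr_eq0; last by move=> i _; rewrite -expr2 sqr_ge0.
  move=> /allP g0; apply/eqP/rowP => i; rewrite mxE; apply/eqP.
  by rewrite -sqrf_eq0 expr2; apply: g0; rewrite mem_index_enum.
move: sz => [sz].
have [sg|[x [sx gx]]] := IH _ sz g.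
  by left; exists 0; rewrite // scale0r subr0.
have [ax|ax] := leP (dot a x) 0.
  by right; exists x; split => // b /[!inE] /orP[/eqP ->//|]; exact: sx.
pose t b := dot b x / dot a x.
have szm : size [seq b - t b *: a | b <- s] = m by rewrite size_map.
have [|[y [sy gy]]] := IH _ szm (g - t g *: a).
  move=> /in_cone_shift[|c c0 gc].
    by move=> b bs; rewrite /t ler_pdivrMr// mul0r sx.
  left; exists (t g + c); first by rewrite addr_ge0// divr_ge0// ltW.
  by rewrite scalerDl opprD addrA.
right; exists (y - (dot a y / dot a x) *: x).
have E b : dot b (y - (dot a y / dot a x) *: x) = dot (b - t b *: a) y.
  by rewrite dotBr dotBl dotZr dotZl /t; field; rewrite gt_eqF.
split; last by rewrite E.
move=> b /[!inE] /orP[/eqP ->|bs]; rewrite E.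
  by rewrite /t divff ?gt_eqF// scale1r subrr dot0l.
by apply: sy; apply/mapP; exists b.
Qed.

End Farkas.

(** * Affine polynomials on a polyhedron *)

Section AffinePolynomials.
Context {R : realType} {d : nat}.
Implicit Types (a : 'rV[R]_d.+1) (p q : mpoly d R) (x : 'rV[R]_d).

(** Affine polynomials are given by their coefficient vectors, constant term
    first, so that Farkas' lemma can be applied to them. *)
Definition affpoly a : mpoly d R :=
  a ord0 ord0 *: 1 + \sum_(i < d) a ord0 (lift ord0 i) *: mpolyX R (mnm1 i).

Lemma affpolyD a b : affpoly (a + b) = affpoly a + affpoly b.
Proof.
rewrite /affpoly addrACA -big_split !mxE scalerDl; congr (_ + _).
by apply: eq_bigr => i _; rewrite !mxE scalerDl.
Qed.

Lemma affpolyZ c a : affpoly (c *: a) = c *: affpoly a.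
Proof.
rewrite /affpoly scalerDr scaler_sumr !mxE scalerA; congr (_ + _).
by apply: eq_bigr => i _; rewrite !mxE scalerA.
Qed.

Lemma affpoly0 : affpoly 0 = 0.
Proof. by rewrite -(scale0r 0) affpolyZ scale0r. Qed.

Lemma degree_le1D p q : degree_le1 p -> degree_le1 q -> degree_le1 (p + q).
Proof.
move=> p1 q1; rewrite /degree_le1 (leq_trans (msizeD_le _ _))// geq_max.
exact/andP.
Qed.

Lemma degree_le1C (c : R) : degree_le1 (c *: 1 : mpoly d R).
Proof. by rewrite /degree_le1 (leq_trans (msizeZ_le _ _))// msize1. Qed.

Lemma degree_le1_var i : degree_le1 (mpolyX R (mnm1 i) : mpoly d R).
Proof. by rewrite /degree_le1 msizeX mdeg1. Qed.

Lemma degree_le1N p : degree_le1 p -> degree_le1 (- p).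
Proof. by rewrite /degree_le1 msizeN. Qed.

Lemma degree_le1P p : degree_le1 p -> exists a, p = affpoly a.
Proof.
move=> p1; exists (\row_(j < d.+1)
  if unlift ord0 j is Some i then mcoeff (mnm1 i) p else mcoeff mnm0 p).
apply/mpolyP => m; rewrite /affpoly !mxE unlift_none mcoeffD mcoeffZ mcoeff1.
rewrite raddf_sum /=.
rewrite (eq_bigr (fun i => mcoeff (mnm1 i) p * (mnm1 i == m)%:R)); last first.
  by move=> i _; rewrite mcoeffZ mcoeffX mxE liftK.
have [m0|] := eqVneq m mnm0.
  rewrite m0 mulr1 big1 ?addr0// => i _.
  by rewrite mnm1_eq0 mulr0.
move=> mn0; rewrite mulr0 add0r.
have [/mdeg1P[i /eqP mi]|m1] := boolP (mdeg m == 1%N).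
  rewrite mi (bigD1 i)//= eqxx mulr1 big1 ?addr0// => j ji.
  by rewrite eq_mnm1 (negbTE ji) mulr0.
rewrite big1 => [|i _]; last first.
  have [im|] := eqVneq (mnm1 i) m; last by rewrite mulr0.
  by move: m1; rewrite -im mdeg1.
apply: memN_msupp_eq0; apply: contraNN m1 => /msize_mdeg_lt/leq_trans/(_ p1).
rewrite ltnS leq_eqVlt ltnS leqn0 => /orP[//|].
by rewrite mdeg_eq0 (negbTE mn0).
Qed.

(** Height 1 gives the value of an affine polynomial at [x], height 0 the value
    of its linear part. *)
Definition homog_coord (t : R) x : 'rV[R]_d.+1 :=
  \row_(j < d.+1) if unlift ord0 j is Some i then x ord0 i else t.

Lemma dot_homog a t x : dot a (homog_coord t x) =
  a ord0 ord0 * t + \sum_(i < d) a ord0 (lift ord0 i) * x ord0 i.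
Proof.
rewrite dotE big_ord_recl !mxE unlift_none; congr (_ + _).
by apply: eq_bigr => i _; rewrite mxE liftK.
Qed.

Lemma peval_affpoly a x : peval (affpoly a) x = dot a (homog_coord 1 x).
Proof.
rewrite dot_homog /peval /affpoly mevalD mevalZ meval1; congr (_ + _).
rewrite raddf_sum /=; apply: eq_bigr => i _.
by rewrite mevalZ mevalXU.
Qed.

Lemma homog_coordE (z : 'rV[R]_d.+1) : exists t x, z = homog_coord t x.
Proof.
exists (z ord0 ord0), (\row_i z ord0 (lift ord0 i)).
by apply/rowP => j; rewrite mxE; case: unliftP => [i ->|->]; rewrite ?mxE.
Qed.

Lemma homog_coordD t s x y :
  homog_coord (t + s) (x + y) = homog_coord t x + homog_coord s y.
Proof. by apply/rowP => j; rewrite !mxE; case: unlift => [i|]; rewrite ?mxE. Qed.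

Lemma homog_coordZ c t x : homog_coord (c * t) (c *: x) = c *: homog_coord t x.
Proof. by apply/rowP => j; rewrite !mxE; case: unlift => [i|]; rewrite ?mxE. Qed.

Lemma in_cone_semiringS k (f : 'I_k -> mpoly d R) s g :
  (forall a, a \in s -> semiringS f (affpoly a)) -> in_cone s g ->
  semiringS f (affpoly g).
Proof.
elim: s g => [g _ /= ->|a s IH g sS /= [c c0 gs]].
  by rewrite affpoly0; exact: semiringS0.
rewrite -(subrK (c *: a) g) affpolyD affpolyZ.
apply: semiringSD; last by apply: semiringSZ => //; apply: sS; rewrite mem_head.
by apply: IH gs => b bs; apply: sS; rewrite inE bs orbT.
Qed.

(** Affine form of Farkas' lemma. If [p] is not a nonnegative combination of 1
    and the [f i], some homogeneous vector (t, v) with t >= 0 separates them.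
    For t > 0, the point v / t of the polyhedron violates p >= 0. For t = 0, the
    ray of direction v from any point of the polyhedron stays in it, and [p]
    decreases to minus infinity along this ray. *)
Lemma affine_nonneg_semiringS k (f : 'I_k -> mpoly d R) p :
  (forall i, degree_le1 (f i)) -> semialg f !=set0 -> degree_le1 p ->
  (forall x, semialg f x -> 0 <= peval p x) -> semiringS f p.
Proof.
move=> f1 [x0 fx0] /degree_le1P[g ->] p0.
have /choice[a fa] : forall i, exists a, f i = affpoly a.
  by move=> i; exact: degree_le1P.
pose e0 : 'rV[R]_d.+1 := \row_j (j == ord0)%:R.
have e0E : affpoly e0 = 1.
  rewrite /affpoly mxE eqxx scale1r big1 ?addr0// => i _.
  by rewrite mxE scale0r.
have [|[z [sz gz]]] := farkas (e0 :: [seq a i | i <- enum 'I_k]) g.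
  apply: in_cone_semiringS => b /[!inE] /orP[/eqP ->|/mapP[i _ ->]].
    by rewrite e0E; exact: semiringS1.
  by rewrite -fa; exact: semiringS_gen.
have [t [v zE]] := homog_coordE (- z).
have dN b : dot b z = - dot b (homog_coord t v).
  by rewrite -zE -[- z]scaleN1r dotZr mulN1r opprK.
have fv i : 0 <= dot (a i) (homog_coord t v).
  rewrite -oppr_le0 -dN; apply: sz; rewrite inE map_f ?orbT//.
  by rewrite mem_enum.
have {gz}gv : dot g (homog_coord t v) < 0 by rewrite -oppr_gt0 -dN.
have t0 : 0 <= t.
  have /= := sz _ (mem_head _ _); rewrite dN oppr_le0 dot_homog mxE eqxx mul1r.
  by rewrite big1 ?addr0// => i _; rewrite mxE mul0r.
move: t0; rewrite le_eqVlt => /orP[/eqP t0|t0].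
  (* The direction v is a recession direction of the polyhedron along which
     the polynomial decreases; s is chosen so that its value drops to -1. *)
  rewrite -t0 in fv gv.
  pose A := peval (affpoly g) x0; pose B := dot g (homog_coord 0 v).
  have A0 : 0 <= A by exact: p0.
  pose s := (A + 1) / - B.
  have s0 : 0 <= s by rewrite divr_ge0 ?oppr_ge0 ?ltW// ltr_wpDl.
  have E b : peval (affpoly b) (x0 + s *: v) =
      peval (affpoly b) x0 + s * dot b (homog_coord 0 v).
    rewrite !peval_affpoly -dotZr -dotDr -homog_coordZ -homog_coordD.
    by rewrite mulr0 addr0.
  have fxs : semialg f (x0 + s *: v).
    move=> i; rewrite fa E; apply: addr_ge0; last exact: mulr_ge0.
    by have := fx0 i; rewrite fa.
  move: (p0 _ fxs); rewrite E -/A -/B (_ : A + s * B = -1).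
    by rewrite oppr_ge0 ler10.
  by rewrite /s; field; rewrite lt_eqF.
have E b : peval (affpoly b) (t^-1 *: v) = t^-1 * dot b (homog_coord t v).
  by rewrite peval_affpoly -dotZr -homog_coordZ mulVf ?gt_eqF.
have ftv : semialg f (t^-1 *: v).
  by move=> i; rewrite fa E; apply: mulr_ge0 => //; rewrite invr_ge0 ltW.
by move: (p0 _ ftv); rewrite E leNgt pmulr_rlt0 ?invr_gt0// gv.
Qed.

End AffinePolynomials.

(** * Bernstein expansions on the unit cube *)

Section Bernstein.

(** The expansion is exact with falling factorials instead of powers of [a]:
    the weight [a ^_ b] turns the binomial expansion of degree n into the one of
    degree n - b. *)
Lemma bernstein_ffact (A : comNzRingType) (u v : A) n b : u + v = 1 ->
  (n ^_ b)%:R * u ^+ b =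
  \sum_(a < n.+1) (a ^_ b * 'C(n, a))%:R * (u ^+ a * v ^+ (n - a)).
Proof.
move=> uv; elim: b n => [|b IH] n.
  rewrite ffactn0 mulr1 -[LHS](expr1n A n) -[X in X ^+ n]uv addrC exprDn.
  by apply: eq_bigr => a _; rewrite ffactn0 mul1n mulr_natl [u ^+ _ * _]mulrC.
case: n => [|n].
  by rewrite big_ord1 ffact0n /= !mul0r.
rewrite big_ord_recl ffact0n /= mul0n mul0r add0r ffactSS natrM exprS.
rewrite (_ : _ * _ = n.+1%:R * u * ((n ^_ b)%:R * u ^+ b)); last by ring.
rewrite IH mulr_sumr; apply: eq_bigr => a _.
rewrite /bump /= add1n subSS ffactSS mulnAC -mul_bin_diag -mulnA !natrM exprS.
ring.
Qed.

Context {R : realType}.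

(** The coefficient, at index [a], of the [b]-th power of the variable in the
    Bernstein basis of degree [n]. *)
Definition ffact_ratio n b a : R := (a ^_ b)%:R / (n ^_ b)%:R.

Lemma ffact_ratioS n b a :
  ffact_ratio n b.+1 a = ffact_ratio n b a * ((a - b)%:R / (n - b)%:R).
Proof. by rewrite /ffact_ratio !ffactnSr !natrM invfM mulrACA. Qed.

Lemma ratio01 n a : (a <= n)%N -> 0 <= (a%:R / n%:R : R) <= 1.
Proof.
move=> an; rewrite divr_ge0//=; case: n an => [|n] an.
  by rewrite invr0 mulr0.
by rewrite ler_pdivrMr// mul1r ler_nat.
Qed.

Lemma ffact_ratio01 n b a : (a <= n)%N -> 0 <= ffact_ratio n b a <= 1.
Proof.
move=> an; apply: ratio01.
elim: b => // b IH; rewrite !ffactnSr leq_mul// leq_sub2r//.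
Qed.

Lemma shifted_ratio_approx (D n b a : nat) : (b <= D)%N -> (D < n)%N -> (a <= n)%N ->
  `|(a - b)%:R / (n - b)%:R - a%:R / n%:R| <= D%:R / (n - D)%:R :> R.
Proof.
move=> bD Dn an.
have n0 : 0 < n%:R :> R by rewrite ltr0n (leq_ltn_trans _ Dn).
have nb0 : 0 < (n - b)%:R :> R by rewrite ltr0n subn_gt0 (leq_ltn_trans bD).
have nD0 : 0 < (n - D)%:R :> R by rewrite ltr0n subn_gt0.
have bn : (b <= n)%N by rewrite (leq_trans bD)// ltnW.
have le1 : b%:R / (n - b)%:R <= D%:R / (n - D)%:R :> R.
  rewrite ler_pM// ?ler_nat// lef_pV2 ?posrE// ler_nat leq_sub2l//.
apply: le_trans le1; have [ab|ba] := leqP a b.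
  rewrite (eqP (_ : (a - b)%N == 0%N)) ?subn_eq0// mul0r sub0r normrN.
  rewrite ger0_norm ?divr_ge0// ler_pM// ?ler_nat//.
  by rewrite lef_pV2 ?posrE// ler_nat leq_subr.
(* Here no subtraction is truncated; for a <= b the first ratio was 0. *)
rewrite natrB 1?ltnW// [in X in `|X|]natrB// distrC.
have -> : a%:R / n%:R - (a%:R - b%:R) / (n%:R - b%:R) =
    b%:R / (n - b)%:R * ((n%:R - a%:R) / n%:R) :> R.
  rewrite natrB//; field; rewrite gt_eqF//= -natrB// gt_eqF//.
rewrite -natrB//; have /andP[h0 h1] := @ratio01 n (n - a) (leq_subr _ _).
by rewrite ger0_norm ?mulr_ge0// ler_piMr.
Qed.

(** The ratio is the product of the [b] factors (a - j) / (n - j), each of which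
    is close to a / n. *)
Lemma ffact_ratio_approx (D n b a : nat) : (b <= D)%N -> (D < n)%N -> (a <= n)%N ->
  `|ffact_ratio n b a - (a%:R / n%:R) ^+ b| <= b%:R * (D%:R / (n - D)%:R).
Proof.
move=> + Dn an; elim: b => [|b IH] bD.
  by rewrite mul0r /ffact_ratio !ffactn0 divr1 expr0 subrr normr0.
rewrite ffact_ratioS exprSr.
set x := ffact_ratio _ _ _ in IH *; set y := _ ^+ b in IH *.
set s := _ / _; set t := a%:R / _.
rewrite (_ : _ - _ = (x - y) * s + y * (s - t)); last by ring.
have /andP[s0 s1] : 0 <= s <= 1 by apply: ratio01; rewrite leq_sub2r.
have /andP[t0 t1] : 0 <= t <= 1 by exact: ratio01.
rewrite (le_trans (ler_normD _ _))// -natr1 [leRHS]mulrDl mul1r lerD//.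
  by rewrite normrM (ger0_norm s0) (le_trans _ (IH (ltnW bD)))// ler_piMr.
rewrite normrM (le_trans _ (shifted_ratio_approx (ltnW bD) Dn an))//.
by rewrite ger0_norm ?exprn_ge0// ler_piMl// exprn_ile1.
Qed.

Lemma dist_prod_le (I : Type) (r : seq I) (x y : I -> R) :
  (forall i, 0 <= x i <= 1) -> (forall i, 0 <= y i <= 1) ->
  `|\prod_(i <- r) x i - \prod_(i <- r) y i| <= \sum_(i <- r) `|x i - y i|.
Proof.
move=> x01 y01; elim: r => [|i r IH]; first by rewrite !big_nil subrr normr0.
rewrite !big_cons; set X := \prod_(i <- r) x i in IH *.
set Y := \prod_(i <- r) y i in IH *.
have /andP[X0 X1] : 0 <= X <= 1.
  by rewrite prodr_ge0 ?prodr_ile1// => j _; have /andP[] := x01 j.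
rewrite (_ : _ - _ = (x i - y i) * X + y i * (X - Y)); last by ring.
have /andP[yi0 yi1] := y01 i.
rewrite (le_trans (ler_normD _ _))// lerD// normrM.
  by rewrite (ger0_norm X0) ler_piMr.
by rewrite (ger0_norm yi0) (le_trans _ IH)// ler_piMl.
Qed.

Context {d : nat}.
Implicit Types (p q : mpoly d R) (u : d.-tuple (mpoly d R)).

Definition bern_poly n u (a : {ffun 'I_d -> 'I_n.+1}) : mpoly d R :=
  \prod_(i < d) ('C(n, a i)%:R *: (tnth u i ^+ a i * (1 - tnth u i) ^+ (n - a i))).

Definition bern_coef n p (a : {ffun 'I_d -> 'I_n.+1}) : R :=
  \sum_(m <- msupp p) mcoeff m p * \prod_(i < d) ffact_ratio n (m i) (a i).

Lemma mnm_le_mdeg (m : multinom d) i : (m i <= mdeg m)%N.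
Proof. by rewrite mdegE (bigD1 i)//= leq_addr. Qed.

Lemma bern_expansion n p u : (msize p <= n)%N ->
  comp_mpoly u p = \sum_(a : {ffun 'I_d -> 'I_n.+1}) bern_coef p a *: bern_poly u a.
Proof.
move=> pn; rewrite comp_mpolyE.
under [RHS]eq_bigr do rewrite /bern_coef scaler_suml.
rewrite exchange_big /=; apply: eq_big_seq => m mp.
have mn i : (m i <= n)%N.
  by rewrite (leq_trans (mnm_le_mdeg m i))// (leq_trans _ pn)// ltnW// msize_mdeg_lt.
under [RHS]eq_bigr do rewrite -scalerA; rewrite -scaler_sumr; congr (_ *: _).
rewrite (eq_bigr (fun i : 'I_d => \sum_(j < n.+1) ffact_ratio n (m i) j *:
  ('C(n, j)%:R *: (tnth u i ^+ j * (1 - tnth u i) ^+ (n - j))))); last first.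
  move=> i _; have := @bernstein_ffact _ (tnth u i) (1 - tnth u i) n (m i).
  rewrite addrC subrK => /(_ erefl) E.
  have c0 : (n ^_ m i)%:R != 0 :> R by rewrite pnatr_eq0 -lt0n ffact_gt0.
  apply: (scalerI c0); rewrite [LHS]scaler_nat -[LHS]mulr_natl E scaler_sumr.
  apply: eq_bigr => j _; rewrite /ffact_ratio !scalerA.
  rewrite (_ : _ * _ * _ = (j ^_ m i * 'C(n, j))%:R :> R).
    by rewrite scaler_nat mulr_natl.
  by rewrite natrM; field.
rewrite bigA_distr_bigA /=; apply: eq_bigr => a _.
by rewrite scaler_prod.
Qed.

Lemma bern_coef_approx p (e : R) : 0 < e -> exists N, forall n, (N <= n)%N ->
  forall a : {ffun 'I_d -> 'I_n.+1},
  `|bern_coef p a - meval (fun i => (a i)%:R / n%:R) p| <= e.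
Proof.
move=> e0; pose D := msize p.
pose C : R := \sum_(m <- msupp p) `|mcoeff m p|.
have C0 : 0 <= C by exact: sumr_ge0.
pose M := (Num.truncn (C * (D%:R * D%:R) / e)).+1.
exists (D + M)%N => n DMn a.
have Dn : (D < n)%N by rewrite (leq_trans _ DMn)// addnS ltnS leq_addr.
have nD0 : 0 < (n - D)%:R :> R by rewrite ltr0n subn_gt0.
rewrite mevalE /bern_coef -sumrB.
have term m : m \in msupp p ->
   `|mcoeff m p * \prod_(i < d) ffact_ratio n (m i) (a i) -
     mcoeff m p * \prod_(i < d) ((a i)%:R / n%:R) ^+ m i| <=
   `|mcoeff m p| * (D%:R * (D%:R / (n - D)%:R)).
  move=> mp; rewrite -mulrBr normrM ler_wpM2l//.
  have mD : (mdeg m <= D)%N by rewrite ltnW// msize_mdeg_lt.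
  have an i : (a i <= n)%N by rewrite -ltnS.
  rewrite (le_trans (dist_prod_le _ _ _))//.
  - by move=> i; exact: ffact_ratio01.
  - move=> i; have /andP[r0 r1] := ratio01 (an i).
    by rewrite exprn_ge0//= exprn_ile1.
  rewrite (@le_trans _ _ (\sum_(i < d) (m i)%:R * (D%:R / (n - D)%:R)))//.
    apply: ler_sum => i _; apply: ffact_ratio_approx => //.
    by rewrite (leq_trans (mnm_le_mdeg _ _)).
  by rewrite -mulr_suml -natr_sum -mdegE ler_wpM2r ?ler_nat// divr_ge0.
rewrite (le_trans (ler_norm_sum _ _ _))//.
rewrite (@le_trans _ _ (C * (D%:R * (D%:R / (n - D)%:R))))//.
  rewrite /C mulr_suml big_seq [leRHS]big_seq; apply: ler_sum => m.
  exact: term.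
rewrite !mulrA ler_pdivrMr// [leRHS]mulrC -ler_pdivrMr// -[X in X / e]mulrA.
rewrite ltW// (lt_le_trans (truncnS_gt _))// ler_nat leq_subRL//.
by rewrite ltnW.
Qed.

End Bernstein.

(** * Bernstein expansions on the cube [-c, c]^d *)

Section CubeBernstein.
Context {R : realType} {d : nat}.
Implicit Types (p : mpoly d R) (c : R).

Definition lower_form c (i : 'I_d) : mpoly d R := c *: 1 + mpolyX R (mnm1 i).
Definition upper_form c (i : 'I_d) : mpoly d R := c *: 1 - mpolyX R (mnm1 i).

(** The tensor Bernstein basis: in each direction, the forms of the two opposite
    faces of the cube, divided by 2 c, add up to 1. *)
Definition cube_bern c n (a : {ffun 'I_d -> 'I_n.+1}) : mpoly d R :=
  \prod_(i < d) ('C(n, a i)%:R *: (((2 * c)^-1 *: lower_form c i) ^+ a i *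
    ((2 * c)^-1 *: upper_form c i) ^+ (n - a i))).

Definition grid_point c n (a : {ffun 'I_d -> 'I_n.+1}) : 'rV[R]_d :=
  \row_i (2 * c * ((a i)%:R / n%:R) - c).

(** The common source of both halves of the theorem: a polynomial that is
    positive on the cube gets nonnegative coefficients, and a functional that is
    nonnegative on the basis gets close to a combination of point evaluations
    with nonnegative weights. *)
Lemma cube_bernP p c (e : R) : 0 < c -> 0 < e -> exists N, forall n, (N <= n)%N ->
  exists2 b : {ffun 'I_d -> 'I_n.+1} -> R, 
    p = \sum_(a : {ffun 'I_d -> 'I_n.+1}) b a *: cube_bern c a &
  forall a, `|b a - peval p (grid_point c a)| <= e.
Proof.
move=> c0 e0.
(* The substitution w carries the cube to the unit cube, and u inverts it. *)
pose u : d.-tuple (mpoly d R) := [tuple (2 * c)^-1 *: lower_form c i | i < d].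
pose w : d.-tuple (mpoly d R) :=
  [tuple (2 * c) *: mpolyX R (mnm1 i) - c *: 1 | i < d].
pose q := comp_mpoly w p.
have c20 : 2 * c != 0 by rewrite gt_eqF// mulr_gt0.
have uq : comp_mpoly u q = p.
  rewrite /q [X in comp_mpoly u X]comp_mpolyE raddf_sum /= [RHS]mpolyE.
  apply: eq_bigr => m _.
  rewrite comp_mpolyZ; congr (_ *: _); rewrite rmorph_prod mpolyXE_id /=.
  apply: eq_bigr => i _; rewrite rmorphXn /=; congr (_ ^+ _).
  rewrite tnth_mktuple comp_mpolyB !comp_mpolyZ comp_mpoly1 comp_mpolyXU.
  rewrite -tnth_nth tnth_mktuple scalerA divff// scale1r /lower_form.
  by rewrite addrC addKr.
have [N NP] := bern_coef_approx q e0.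
exists (maxn (msize q) N) => n; rewrite geq_max => /andP[qn Nn].
exists (bern_coef q (n := n)) => [|a].
  rewrite -{1}uq (bern_expansion _ qn); apply: eq_bigr => a _.
  congr (_ *: _); apply: eq_bigr => i _; rewrite tnth_mktuple.
  congr (_ *: (_ * _ ^+ _)); rewrite /lower_form /upper_form.
  apply: (scalerI c20); rewrite scalerBr !scalerA divff// !scale1r.
  by rewrite mulr_natl mulr2n scalerDl opprD addrA addrK.
rewrite /peval (_ : meval _ p = meval (fun i => (a i)%:R / n%:R) q); first exact: NP.
rewrite /q comp_mpoly_meval; apply: meval_eq => i.
by rewrite mxE tnth_mktuple mevalB !mevalZ meval1 mevalXU mulr1.
Qed.

End CubeBernstein.

(** * Evaluation of polynomials *)

Section Evaluation.
Context {R : realType} {d : nat}.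
Implicit Types (p q : mpoly d R) (x : 'rV[R]_d).

Lemma pevalD p q x : peval (p + q) x = peval p x + peval q x.
Proof. exact: mevalD. Qed.
Lemma pevalB p q x : peval (p - q) x = peval p x - peval q x.
Proof. exact: mevalB. Qed.
Lemma pevalM p q x : peval (p * q) x = peval p x * peval q x.
Proof. exact: mevalM. Qed.
Lemma pevalZ c p x : peval (c *: p) x = c * peval p x.
Proof. exact: mevalZ. Qed.
Lemma peval1 x : peval 1 x = 1.
Proof. exact: meval1. Qed.
Lemma peval0 x : peval 0 x = 0.
Proof. exact: meval0. Qed.
Lemma peval_var i x : peval (mpolyX R (mnm1 i)) x = x ord0 i.
Proof. exact: mevalXU. Qed.
Lemma peval_sum (I : Type) (r : seq I) (P : pred I) (F : I -> mpoly d R) x :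
  peval (\sum_(i <- r | P i) F i) x = \sum_(i <- r | P i) peval (F i) x.
Proof. exact: raddf_sum. Qed.
Lemma peval_prod (I : Type) (r : seq I) (P : pred I) (F : I -> mpoly d R) x :
  peval (\prod_(i <- r | P i) F i) x = \prod_(i <- r | P i) peval (F i) x.
Proof. exact: rmorph_prod. Qed.
Lemma pevalX p n x : peval (p ^+ n) x = peval p x ^+ n.
Proof. exact: rmorphXn. Qed.

Lemma peval_continuous p : continuous (peval p : 'rV[R]_d -> R).
Proof.
have cD (a b : mpoly d R) : continuous (peval a) -> continuous (peval b) ->
    continuous (peval (a + b)).
  move=> ca cb x; rewrite (_ : peval _ = peval a \+ peval b).
    exact: continuousD (ca x) (cb x).
  by apply/funext => y; rewrite pevalD.
have cM (a b : mpoly d R) : continuous (peval a) -> continuous (peval b) ->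
    continuous (peval (a * b)).
  move=> ca cb x; rewrite (_ : peval _ = peval a \* peval b).
    exact: continuousM (ca x) (cb x).
  by apply/funext => y; rewrite pevalM.
have c1 : continuous (peval (1 : mpoly d R)).
  rewrite (_ : peval _ = cst 1); first exact: cst_continuous.
  by apply/funext => y; rewrite peval1.
have cX i : continuous (peval (mpolyX R (mnm1 i) : mpoly d R)).
  rewrite (_ : peval _ = fun y => y ord0 i); first exact: coord_continuous.
  by apply/funext => y; rewrite peval_var.
rewrite [p]mpolyE; apply: (big_ind (fun q => continuous (peval q))) => [||m _].
- rewrite (_ : peval _ = cst 0); first exact: cst_continuous.
  by apply/funext => y; rewrite peval0.
- exact: cD.
rewrite -[mpolyX _ _]mul1r scalerAl; apply: (cM).
  rewrite (_ : peval _ = cst (mcoeff m p)); first exact: cst_continuous.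
  by apply/funext => y; rewrite pevalZ peval1 mulr1.
rewrite mpolyXE_id; apply: (big_ind (fun q => continuous (peval q))) => [||i _].
- exact: c1.
- exact: cM.
by elim: (m i) => [|l IH]; [rewrite expr0|rewrite exprS; exact: cM].
Qed.

Lemma peval_lt_bound (X : set 'rV[R]_d) p : compact X ->
  exists2 C, 0 < C & forall x, X x -> peval p x < C.
Proof.
move=> cX; have [X0|X0] := pselect (X !=set0); last first.
  by exists 1 => // x Xx; exfalso; apply: X0; exists x.
have [|c _ cmax] := @compact_EVT_max _ _ (peval p) _ X0 cX.
  by apply: continuous_subspaceT; exact: peval_continuous.
exists (`|peval p c| + 1); first by rewrite ltr_wpDl.
move=> x Xx; rewrite (le_lt_trans (cmax x _)) ?inE//.
by rewrite (le_lt_trans (ler_norm _))// ltrDl.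
Qed.

End Evaluation.

(** * From positivity on a subset to positivity on a compact set *)

Section PositivePerturbation.
Context {R : realType}.

(** For t in [0, 1], the sum of the t (1 - t) ^ i over i <= n telescopes to
    1 - (1 - t) ^ n.+1, which is at most 1, and its last term is its smallest. *)
Lemma mul_expr_onem_le (t : R) n : t <= 1 -> t * (1 - t) ^+ n <= n.+1%:R^-1.
Proof.
move=> t1; have [t0|t0] := leP t 0.
  by rewrite (@le_trans _ _ 0)// mulr_le0_ge0// exprn_ge0// subr_ge0.
have s0 : 0 <= 1 - t by rewrite subr_ge0.
have s1 : 1 - t <= 1 by rewrite lerBlDr lerDl ltW.
rewrite -[leRHS]mul1r ler_pdivlMr//.
have -> : t * (1 - t) ^+ n * n.+1%:R = \sum_(i < n.+1) t * (1 - t) ^+ n.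
  by rewrite sumr_const card_ord mulr_natr.
rewrite (@le_trans _ _ (\sum_(i < n.+1) t * (1 - t) ^+ i))//.
  apply: ler_sum => i _; rewrite ler_wpM2l ?(ltW t0)// ler_wiXn2l//.
  by rewrite -ltnS.
rewrite -mulr_sumr; set S := \sum_(_ < _) _.
rewrite (_ : t * S = - ((1 - t - 1) * S)); last by ring.
by rewrite -subrX1 opprB lerBlDr lerDl exprn_ge0.
Qed.

Lemma bernoulli_ineq (e : R) n : 0 <= e -> 1 + n%:R * e <= (1 + e) ^+ n.
Proof.
move=> e0; elim: n => [|n IH]; first by rewrite mul0r addr0 expr0.
rewrite exprS (le_trans _ (ler_wpM2l _ IH)) ?addr_ge0//.
rewrite -natr1 (_ : (1 + e) * _ = 1 + (n%:R + 1) * e + n%:R * e * e); last by ring.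
by rewrite lerDl !mulr_ge0.
Qed.

(** By compactness there is e > 0 such that every point of [X] satisfies h >= e
    or q j <= - e for some j. In the first case the perturbation is too small to
    spoil positivity, being at most r / n.+1. In the second one, the j-th term
    alone is at most - e (1 + e) ^ n, which outweighs the lower bound of h on [X]
    and the other terms. *)
Lemma positive_perturbation (T : topologicalType) (X : set T) (r : nat)
    (q : 'I_r -> T -> R) (h : T -> R) : compact X ->
  continuous h -> (forall j, continuous (q j)) ->
  (forall j x, X x -> q j x <= 1) ->
  (forall x, X x -> (forall j, 0 <= q j x) -> 0 < h x) ->
  exists n, forall x, X x -> 0 < h x - \sum_j q j x * (1 - q j x) ^+ n.
Proof.
move=> cX ch cq q1 hpos; have [X0|X0] := pselect (X !=set0); last first.
  by exists 0%N => x Xx; exfalso; apply: X0; exists x.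
(* The positive part of h plus the negative parts of the q j, all doubled. *)
pose g x := (`|h x| + h x) + \sum_(j < r) (`|q j x| - q j x).
have g1 y : 0 <= `|y| + y :> R by rewrite -lerBlDr sub0r -normrN ler_norm.
have g2 y : 0 <= `|y| - y :> R by rewrite subr_ge0 ler_norm.
have cg : continuous g.
  move=> x; apply: cvgD.
    by apply: cvgD; [apply: cvg_norm; exact: ch|exact: ch].
  apply: (cvg_big add_continuous) => j _.
  by apply: cvgB; [apply: cvg_norm; exact: cq|exact: cq].
have gpos x : X x -> 0 < g x.
  move=> Xx; rewrite lt_def addr_ge0 ?g1 ?sumr_ge0// andbT.
  apply/eqP => /eqP; rewrite paddr_eq0 ?g1 ?sumr_ge0// => /andP[h0 q0].
  have : 0 < h x.
    apply: hpos => // j; move: q0; rewrite psumr_eq0// => /allP/(_ j (mem_index_enum _)).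
    by rewrite /= subr_eq0 => /eqP <-.
  by move=> hx; move: h0; rewrite gtr0_norm// paddr_eq0 ?ltW// gt_eqF.
have [|x0 /set_mem Xx0 gmin] := @compact_EVT_min _ _ g _ X0 cX.
  exact: continuous_subspaceT.
have [|x1 /set_mem Xx1 hmin] := @compact_EVT_min _ _ h _ X0 cX.
  exact: continuous_subspaceT.
pose M := `|h x1|; pose e := g x0 / (2 * r.+1%:R).
have e0 : 0 < e by rewrite divr_gt0 ?gpos// mulr_gt0.
have hM x : X x -> - M <= h x.
  by move=> Xx; rewrite (le_trans _ (hmin _ (mem_set Xx)))// /M lerNl -normrN ler_norm.
have split_cases x : X x -> e <= h x \/ exists j, q j x <= - e.
  move=> Xx; have [|he] := leP e (h x); [by left|right].
  apply: contrapT => qe; have {}qe j : - e < q j x.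
    by rewrite ltNge; apply/negP => qj; apply: qe; exists j.
  have : g x0 <= g x by apply: gmin; rewrite inE.
  apply/negP; rewrite -ltNge.
  have two y : y < e -> `|y| + y < 2 * e.
    by move=> ye; have [y0|y0] := ltP y 0; [rewrite ltr0_norm// addNr mulr_gt0|
      rewrite ger0_norm//; lra].
  have -> : g x0 = 2 * e + \sum_(j < r) 2 * e.
    rewrite sumr_const card_ord -mulrS -mulr_natr /e; field.
    by rewrite nat1r pnatr_eq0.
  rewrite ltr_leD ?two//; apply: ler_sum => j _.
  by rewrite ltW// -normrN two// ltrNl.
(* The first bound gives r / n.+1 < e, the second one M < n e ^ 2. *)
pose n := maxn (Num.truncn (r%:R / e)).+1 (Num.truncn (M / (e * e))).+1.
have n1 : r%:R / n.+1%:R < e.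
  rewrite ltr_pdivrMr// mulrC -ltr_pdivrMr//.
  by rewrite (lt_le_trans (truncnS_gt _))// ler_nat ltnW// ltnS leq_maxl.
have n2 : M < n%:R * (e * e).
  rewrite -ltr_pdivrMr ?(mulr_gt0 e0 e0)//.
  by rewrite (lt_le_trans (truncnS_gt _))// ler_nat leq_maxr.
exists n => x Xx; rewrite subr_gt0.
pose F j := q j x * (1 - q j x) ^+ n.
have Fle j : F j <= n.+1%:R^-1 by apply: mul_expr_onem_le; exact: q1.
have sumF (P : pred 'I_r) : \sum_(j | P j) F j < e.
  apply: le_lt_trans n1; rewrite (@le_trans _ _ (\sum_(j | P j) n.+1%:R^-1))//.
    exact: ler_sum.
  by rewrite sumr_const -[leLHS]mulr_natl ler_wpM2r// ler_nat -[leqRHS]card_ord max_card.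
have [eh|[j qj]] := split_cases _ Xx; first exact: lt_le_trans (sumF _) eh.
rewrite (bigD1 j)//= -/(F j).
have Fj : F j <= - (e + n%:R * (e * e)).
  have -> : - (e + n%:R * (e * e)) = - (e * (1 + n%:R * e)) by ring.
  have eq : e <= - q j x by rewrite lerNr.
  rewrite lerNr /F -mulNr; apply: ler_pM => //; first exact: ltW.
    by rewrite addr_ge0// mulr_ge0// ltW.
  rewrite (le_trans (bernoulli_ineq _ (ltW e0)))// lerXn2r ?nnegrE ?lerD2l//.
    by rewrite addr_ge0// ltW.
  by rewrite addr_ge0// (le_trans (ltW e0)).
have := sumF (fun i => i != j); have := hM _ Xx; move: Fj n2.
set s := \sum_(_ | _) _; rewrite -/s; lra.
Qed.

End PositivePerturbation.

(** * Representation of positive polynomials *)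

Section Positivstellensatz.
Context {R : realType} {d k : nat} (f : 'I_k -> mpoly d R).
Hypothesis f_linear : forall i, degree_le1 (f i).
Hypothesis K_compact : compact (semialg f).
Hypothesis K_nonempty : semialg f !=set0.

Definition cube (c : R) : set 'rV[R]_d := [set x | forall i, `|x ord0 i| <= c].

Lemma cube_compact c : compact (cube c).
Proof.
rewrite (_ : cube c = [set x : 'rV[R]_d | forall i, `[- c, c]%classic (x ord0 i)]).
  by apply: (@rV_compact _ _ (fun=> `[- c, c]%classic)) => _; exact: segment_compact.
by apply/seteqP; split => x /= xc i; have := xc i; rewrite /= in_itv/= ler_norml.
Qed.

Lemma grid_point_cube c n (a : {ffun 'I_d -> 'I_n.+1}) :
  0 < c -> cube c (grid_point c a).
Proof.
move=> c0 i; rewrite mxE ler_norml.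
have /andP[t0 t1] := @ratio01 R n (a i) (ltn_ord (a i)).
set t := _ / _ in t0 t1 *.
have ct0 : 0 <= c * t by rewrite mulr_ge0// ltW.
have ct1 : c * t <= c by rewrite ler_piMr// ltW.
apply/andP; split; lra.
Qed.

Lemma compact_semialg_sub_cube : exists2 c, 0 < c & semialg f `<=` cube c.
Proof.
have [M [_ MK]] := compact_bounded K_compact.
exists (`|M| + 1); first by rewrite ltr_wpDl.
move=> x Kx i.
have := MK (`|M| + 1) _ x Kx; rewrite (le_lt_trans (ler_norm M)) ?ltrDl// => /(_ isT).
by apply: le_trans; rewrite [leRHS]mx_normrE; exact: (le_bigmax _ _ (ord0, i)).
Qed.

(** This is how compactness of the polyhedron enters the algebra: the forms of
    the faces of a cube around it are nonnegative on it. *)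
Lemma cube_forms_semiringS c : semialg f `<=` cube c ->
  forall i, semiringS f (lower_form c i) /\ semiringS f (upper_form c i).
Proof.
move=> Kc i; split; apply: affine_nonneg_semiringS => //.
- by apply: degree_le1D; [exact: degree_le1C|exact: degree_le1_var].
- move=> x /Kc/(_ i); rewrite ler_norml => /andP[xl _].
  by rewrite pevalD pevalZ peval1 mulr1 peval_var addrC -lerBlDr sub0r.
- by apply: degree_le1D; [exact: degree_le1C|apply: degree_le1N; exact: degree_le1_var].
- move=> x /Kc/(_ i); rewrite ler_norml => /andP[_ xl].
  by rewrite pevalB pevalZ peval1 mulr1 peval_var subr_ge0.
Qed.

Lemma cube_bern_semiringS c n (a : {ffun 'I_d -> 'I_n.+1}) : 0 < c ->
  semialg f `<=` cube c -> semiringS f (cube_bern c a).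
Proof.
move=> c0 Kc; apply: semiringS_prod => i _.
have [fl fu] := cube_forms_semiringS Kc i.
have c2 : 0 <= (2 * c)^-1 by rewrite invr_ge0 mulr_ge0// ltW.
by apply: semiringSZ => //; apply: semiringSM; apply: semiringSX; exact: semiringSZ.
Qed.

Lemma cube_pos_semiringS c p : 0 < c -> semialg f `<=` cube c ->
  (forall x, cube c x -> 0 < peval p x) -> semiringS f p.
Proof.
move=> c0 Kc ppos.
have C0 : cube c !=set0 by exists 0 => i; rewrite mxE normr0 ltW.
have [|x0 /set_mem Xx0 pmin] := @compact_EVT_min _ _ (peval p) _ C0 (@cube_compact c).
  by apply: continuous_subspaceT; exact: peval_continuous.
have [N NP] := cube_bernP p c0 (ppos _ Xx0).
have [b pE bP] := NP N (leqnn N).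
rewrite pE; apply: semiringS_sum => a _; apply: semiringSZ; last first.
  exact: cube_bern_semiringS.
have := bP a; rewrite ler_norml => /andP[+ _]; rewrite lerBrDl.
apply: le_trans; rewrite subr_ge0; apply: pmin.
by rewrite inE; exact: grid_point_cube.
Qed.

(** The polynomials q = f i / C perturb [p] into a polynomial that is positive
    on a whole cube. The constant C is so large that 1 - q is positive on the
    cube, which puts its powers in the semiring. *)
Lemma pos_semiringS p : (forall x, semialg f x -> 0 < peval p x) -> semiringS f p.
Proof.
move=> ppos; have [c c0 Kc] := compact_semialg_sub_cube.
have /choice[C CP] : forall i, exists C : R,
    0 < C /\ forall x, cube c x -> peval (f i) x < C.
  by move=> i; have [C] := peval_lt_bound (f i) (@cube_compact c); exists C.
pose q i := (C i)^-1 *: f i.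
have q1 i x : cube c x -> peval (q i) x < 1.
  by have [Ci0 fC] := CP i; move=> /fC; rewrite pevalZ mulrC ltr_pdivrMr// mul1r.
have [n nP] : exists n, forall x, cube c x ->
    0 < peval p x - \sum_i peval (q i) x * (1 - peval (q i) x) ^+ n.
  apply: positive_perturbation; first exact: cube_compact.
  - exact: peval_continuous.
  - by move=> j; exact: peval_continuous.
  - by move=> j x cx; rewrite ltW// q1.
  move=> x cx fx; apply: ppos => i; have := fx i.
  by rewrite pevalZ pmulr_rge0// invr_gt0 (CP i).1.
have pE : p = (p - \sum_i q i * (1 - q i) ^+ n) + \sum_i q i * (1 - q i) ^+ n.
  by rewrite subrK.
rewrite pE; apply: semiringSD.
  apply: (cube_pos_semiringS c0 Kc) => x cx.
  rewrite pevalB peval_sum (lt_le_trans (nP _ cx))// lerD2l lerN2.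
  by apply: ler_sum => i _; rewrite pevalM pevalX pevalB peval1.
apply: semiringS_sum => i _; apply: semiringSM.
  by apply: semiringSZ; [rewrite invr_ge0 ltW// (CP i).1|exact: semiringS_gen].
apply: semiringSX; apply: (cube_pos_semiringS c0 Kc) => x cx.
by rewrite pevalB peval1 subr_gt0 q1.
Qed.

(** The same perturbation as in [pos_semiringS], from the polyhedron to the
    subset where the [g j] are nonnegative. *)
Lemma pos_moduleC r (g : 'I_r.+1 -> mpoly d R) h : g ord0 = 1 ->
  (forall x, (semialg f `&` semialg g) x -> 0 < peval h x) -> moduleC f g h.
Proof.
move=> g0 hpos.
have /choice[C CP] : forall j, exists C : R,
    0 < C /\ forall x, semialg f x -> peval (g j) x < C.
  by move=> j; have [C] := peval_lt_bound (g j) K_compact; exists C.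
pose q j := (C j)^-1 *: g j.
have q1 j x : semialg f x -> peval (q j) x < 1.
  by have [Cj0 gC] := CP j; move=> /gC; rewrite pevalZ mulrC ltr_pdivrMr// mul1r.
have [n nP] : exists n, forall x, semialg f x ->
    0 < peval h x - \sum_j peval (q j) x * (1 - peval (q j) x) ^+ n.
  apply: positive_perturbation => //.
  - exact: peval_continuous.
  - by move=> j; exact: peval_continuous.
  - by move=> j x fx; rewrite ltW// q1.
  move=> x fx gx; apply: hpos; split => // j; have := gx j.
  by rewrite pevalZ pmulr_rge0// invr_gt0 (CP j).1.
pose h' := h - \sum_j q j * (1 - q j) ^+ n.
have h'S : semiringS f h'.
  apply: pos_semiringS => x fx.
  rewrite pevalB peval_sum (lt_le_trans (nP _ fx))// lerD2l lerN2.
  by apply: ler_sum => i _; rewrite pevalM pevalX pevalB peval1.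
pose s j := (C j)^-1 *: (1 - q j) ^+ n.
have sS j : semiringS f (s j).
  apply: semiringSZ; first by rewrite invr_ge0 ltW// (CP j).1.
  apply: semiringSX; apply: pos_semiringS => x fx.
  by rewrite pevalB peval1 subr_gt0 q1.
(* As g ord0 = 1, the remainder h' can be put in the coefficient of g ord0. *)
exists (fun j => s j + (if j == ord0 then h' else 0)); split.
  move=> j; apply: semiringSD => //; case: eqP => // _; exact: semiringS0.
under eq_bigr do rewrite mulrDr.
rewrite big_split/= [X in _ + X](bigD1 ord0)//= g0 mul1r.
rewrite [X in h' + X]big1 ?addr0; last first.
  by move=> j /negbTE ->; rewrite mulr0.
rewrite addrC -[LHS](subrK (\sum_j q j * (1 - q j) ^+ n)).
by congr (_ + _); apply: eq_bigr => j _; rewrite /s /q -scalerAl -scalerAr.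
Qed.

End Positivstellensatz.

(** * Coding the points of the cube by repeated bisection *)

Section Branches.
Context {R : realType} {d : nat} (c : R).
Hypothesis c_gt0 : 0 < c.
Implicit Types (beta : seq bool -> bool) (x : 'rV[R]_d) (s t : seq bool).

(** The latest digit comes first; [beta] chooses the next digit from the digits
    chosen so far. The code of a point of the cube and the address of a real
    number are both produced in this way. *)
Definition branch beta n : seq bool := iter n (fun s => beta s :: s) [::].

Lemma size_branch beta n : size (branch beta n) = n.
Proof. by elim: n => //= n ->. Qed.

(** Step [n] bisects the current box in the direction n mod d. *)
Fixpoint width n (i : 'I_d) : R :=
  if n is n'.+1 then if (n' %% d == i)%N then width n' i / 2 else width n' i
  else 2 * c.

(** The lower corner of the box: the digit 1 selects the upper half. *)
Fixpoint corner s (i : 'I_d) : R :=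
  if s is b :: s' then
    corner s' i + (if b && (size s' %% d == i)%N then width (size s') i / 2 else 0)
  else - c.

Lemma width_ge0 n i : 0 <= width n i.
Proof.
elim: n => /= [|n IH]; first by rewrite mulr_ge0// ltW.
by case: ifP => // _; rewrite divr_ge0.
Qed.

Lemma width_round n i : width (n * d) i = 2 * c / 2 ^+ n.
Proof.
have W m j : (j <= d)%N -> width (m * d + j) i =
    if (i < j)%N then width (m * d) i / 2 else width (m * d) i.
  elim: j => [|j IH] jd; first by rewrite addn0.
  rewrite addnS /= IH ?(ltnW jd)// modnMDl modn_small// ltnS.
  rewrite [(i <= j)%N]leq_eqVlt eq_sym.
  by case: eqVneq => //= <-; rewrite ltnn.
elim: n => [|n IH]; first by rewrite mul0n expr0 divr1.
by rewrite mulSn addnC W// ltn_ord IH exprSr invfM mulrA.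
Qed.

Lemma corner_cons b s i :
  corner s i <= corner (b :: s) i /\
  corner (b :: s) i + width (size s).+1 i <= corner s i + width (size s) i.
Proof.
have w0 := width_ge0 (size s) i.
by rewrite /=; case: (_ == _); case: b => /=; split; lra.
Qed.

Lemma corner_branch beta n m i : (n <= m)%N ->
  corner (branch beta n) i <= corner (branch beta m) i /\
  corner (branch beta m) i + width m i <= corner (branch beta n) i + width n i.
Proof.
move=> /subnK <-; elim: (m - n)%N => [|l [IH1 IH2]]; first by rewrite add0n.
rewrite addSn.
have [] := corner_cons (beta (branch beta (l + n))) (branch beta (l + n)) i.
rewrite size_branch => h1 h2; split; first exact: le_trans IH1 h1.
exact: le_trans h2 IH2.
Qed.

Definition code x := branch (fun s =>
  [forall i : 'I_d, (size s %% d == i)%N ==>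
     (corner s i + width (size s) i / 2 <= x ord0 i)]).

(** The closed boxes allow the points on the upper faces of the cube to be coded
    by the digit 1 for ever. *)
Lemma code_cell x n i : cube c x ->
  corner (code x n) i <= x ord0 i <= corner (code x n) i + width n i.
Proof.
move=> /(_ i); rewrite ler_norml => /andP[x1 x2].
elim: n => [/=|n IH]; first by apply/andP; split; lra.
move: IH => /andP[IH1 IH2].
rewrite /code /= -/(code x n) size_branch.
case: eqP => ni; last by rewrite andbF addr0 IH1 IH2.
have -> : [forall i0 : 'I_d, (n %% d == i0)%N ==>
     (corner (code x n) i0 + width n i0 / 2 <= x ord0 i0)] =
     (corner (code x n) i + width n i / 2 <= x ord0 i).
  apply/forallP/idP => [/(_ i)|h j]; first by rewrite ni eqxx.
  by apply/implyP => /eqP nj; rewrite (_ : j = i)//; apply: val_inj; rewrite /= -nj.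
have [h|h] := leP (corner (code x n) i + width n i / 2) (x ord0 i);
  by rewrite /= ?addr0; apply/andP; split; lra.
Qed.

(** The lower corners increase along a branch, so their supremum is the point
    common to all boxes. *)
Definition branch_limit beta : 'rV[R]_d :=
  \row_i sup (range (fun n => corner (branch beta n) i)).

Lemma branch_limitP beta n i :
  corner (branch beta n) i <= branch_limit beta ord0 i <=
  corner (branch beta n) i + width n i.
Proof.
have ub m l : corner (branch beta m) i <= corner (branch beta l) i + width l i.
  have [ml|lm] := leqP m l.
    have [h _] := corner_branch beta i ml.
    by rewrite (le_trans h)// lerDl width_ge0.
  have [_ h] := corner_branch beta i (ltnW lm).
  by rewrite (le_trans _ h)// lerDl width_ge0.
rewrite mxE; apply/andP; split.
  apply: ub_le_sup; last by exists n.
  by exists (corner (branch beta 0) i + width 0 i) => _ [m _ <-].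
apply: ge_sup; first by exists (corner (branch beta 0) i), 0%N.
by move=> _ [m _ <-].
Qed.

End Branches.

(** * Laying out a tree of masses on the real line *)

Section MassTree.
Context {R : realType} (nu : seq bool -> R).
Hypothesis nu_ge0 : forall s, 0 <= nu s.
Hypothesis nu_split : forall s, nu s = nu (false :: s) + nu (true :: s).
Local Notation leb := (@lebesgue_measure R).

Fixpoint cell_start s : R :=
  if s is b :: s' then cell_start s' + (if b then nu (false :: s') else 0) else 0.

(** The intervals of the two children of [s] cut the interval of [s] in two, the
    child 0 on the left. *)
Definition cell s : set R := `[cell_start s, cell_start s + nu s[%classic.

Definition address (w : R) : seq bool -> bool :=
  fun s => cell_start s + nu (false :: s) <= w.

Lemma cell_split s : cell s = cell (false :: s) `|` cell (true :: s).
Proof.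
have := nu_ge0 (false :: s); have := nu_ge0 (true :: s); have := nu_split s.
rewrite /cell /= addr0 => E n1 n2.
apply/seteqP; split => w /=; rewrite !in_itv/= E.
  move=> /andP[h1 h2].
  have [h|h] := leP (cell_start s + nu (false :: s)) w; [right|left].
    by rewrite -addrA h2.
  by rewrite h1.
move=> [/andP[h1 h2]|/andP[h1 h2]]; apply/andP; split; lra.
Qed.

Lemma cell_disj s : [disjoint cell (false :: s) & cell (true :: s)].
Proof.
rewrite disj_set2E; apply/eqP/seteqP; split => w //=; rewrite /cell /= !in_itv/=.
rewrite addr0 => -[/andP[_ h1] /andP[h2 _]].
by move: (lt_le_trans h1 h2); rewrite ltxx.
Qed.

Lemma address_cell s w : cell s w -> branch (address w) (size s) = s.
Proof.
elim: s => // b s IH wbs.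
have ws : cell s w by rewrite cell_split; case: b wbs; [right|left].
rewrite /= -/(branch _ _) IH//; congr (_ :: _); rewrite /address.
move: wbs; rewrite /cell /= in_itv /=; case: b => /andP[h1 h2]; first exact: h1.
by apply/negbTE; rewrite -ltNge; move: h2; rewrite addr0.
Qed.

Lemma measurable_cell s : measurable (cell s).
Proof. exact: measurable_itv. Qed.

Lemma lebesgue_cell s : leb (cell s) = (nu s)%:E.
Proof.
rewrite /cell lebesgue_measure_itv /= lte_fin ltrDl; case: ltP => h.
  by rewrite -EFinB addrAC subrr add0r.
by congr (_%:E); apply/eqP; rewrite eq_le h nu_ge0.
Qed.

(** Only finitely many thresholds decide the first [n] digits of an address. *)
Lemma measurable_address n (F : seq bool -> R) :
  measurable_fun setT (fun w : R => F (branch (address w) n)).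
Proof.
elim: n F => [|n IH] F; first exact: (measurable_cst (F [::])).
rewrite (_ : (fun _ => _) = (fun w : R => if address w (branch (address w) n)
    then F (true :: branch (address w) n) else F (false :: branch (address w) n))).
  apply: measurable_fun_ifT; [|exact: (IH (fun s => F (true :: s)))|
    exact: (IH (fun s => F (false :: s)))].
  apply: measurable_fun_ler; last exact: measurable_id.
  exact: (IH (fun s => cell_start s + nu (false :: s))).
by apply/funext => w /=; case: (address _ _).
Qed.

Lemma branch_bounded n (F : seq bool -> R) :
  exists M, forall beta, `|F (branch beta n)| <= M.
Proof.
elim: n F => [|n IH] F; first by exists `|F [::]|.
have [M1 h1] := IH (fun s => F (true :: s)).
have [M2 h2] := IH (fun s => F (false :: s)).
exists (Num.max M1 M2) => beta /=; rewrite le_max.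
by case: (beta _); rewrite ?h1 ?h2 ?orbT.
Qed.

Lemma integrable_address n (F : seq bool -> R) s :
  leb.-integrable (cell s) (EFin \o (fun w => F (branch (address w) n))).
Proof.
apply: measurable_bounded_integrable.
- exact: measurable_cell.
- by rewrite [X in (X < _)%E](lebesgue_cell s) ltry.
- by apply: measurable_funTS; exact: measurable_address.
have [M MP] := branch_bounded n F.
exists M; split; first exact: num_real.
by move=> y My w _ /=; rewrite (le_trans (MP _))// ltW.
Qed.

(** The sum of F * rho over the descendants of [t] of depth [n], in the recursive
    form that integrals over cells, sums over grid points and limits of such sums
    satisfy alike. *)
Fixpoint tree_sum (rho F : seq bool -> R) n t : R :=
  if n is n'.+1 then tree_sum rho F n' (false :: t) + tree_sum rho F n' (true :: t)
  else F t * rho t.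

Lemma Rintegral_address (F : seq bool -> R) n t :
  (\int[leb]_(w in cell t) F (branch (address w) (size t + n)))%R = tree_sum nu F n t.
Proof.
elim: n t => [|n IH] t.
  rewrite addn0 /= (@eq_Rintegral _ _ _ _ _ (cst (F t))); last first.
    by move=> w /set_mem wt; rewrite address_cell.
  rewrite Rintegral_cst; last exact: measurable_cell.
  by rewrite [X in fine X](lebesgue_cell t).
rewrite {1}cell_split Rintegral_setU; last 4 first.
- exact: measurable_cell.
- exact: measurable_cell.
- rewrite -cell_split; exact: integrable_address.
- exact: cell_disj.
by rewrite [RHS]/= -!IH addnS.
Qed.

End MassTree.

(** * Polynomials are Lipschitz on the cube *)

Section Lipschitz.
Context {R : realType} {d : nat} (c : R).
Implicit Types (p q : mpoly d R) (x y : 'rV[R]_d).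

Definition lipschitz_on_cube p := exists2 K : R, 0 <= K & forall x y (e : R),
  cube c x -> cube c y -> (forall i, `|x ord0 i - y ord0 i| <= e) -> 0 <= e ->
  `|peval p x - peval p y| <= K * e.

Lemma lipschitzD p q : lipschitz_on_cube p -> lipschitz_on_cube q ->
  lipschitz_on_cube (p + q).
Proof.
move=> [K K0 pK] [M M0 qM]; exists (K + M); first exact: addr_ge0.
move=> x y e cx cy xye e0; rewrite !pevalD opprD addrACA mulrDl.
by rewrite (le_trans (ler_normD _ _))// lerD ?pK ?qM.
Qed.

Lemma peval_norm_bound p : exists2 B : R, 0 <= B &
  forall x, cube c x -> `|peval p x| <= B.
Proof.
have [B1 B10 pB1] := peval_lt_bound p (@cube_compact R d c).
have [B2 B20 pB2] := peval_lt_bound (- p) (@cube_compact R d c).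
exists (B1 + B2); first by rewrite addr_ge0// ltW.
move=> x cx; have := pB1 _ cx; have := pB2 _ cx.
rewrite -[- p]sub0r pevalB peval0 sub0r ler_norml => h1 h2.
by apply/andP; split; lra.
Qed.

Lemma lipschitzM p q : lipschitz_on_cube p -> lipschitz_on_cube q ->
  lipschitz_on_cube (p * q).
Proof.
move=> [K K0 pK] [M M0 qM].
have [A A0 pA] := peval_norm_bound p; have [B B0 qB] := peval_norm_bound q.
exists (A * M + K * B); first by rewrite addr_ge0// mulr_ge0.
move=> x y e cx cy xye e0; rewrite !pevalM.
rewrite (_ : _ - _ = peval p x * (peval q x - peval q y) +
  (peval p x - peval p y) * peval q y); last by ring.
rewrite (le_trans (ler_normD _ _))// !normrM mulrDl lerD//.
  by rewrite -mulrA ler_pM// ?pA// qM.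
by rewrite mulrAC ler_pM// ?qB// pK.
Qed.

Lemma lipschitzC a : lipschitz_on_cube (a *: 1).
Proof.
exists 0 => // x y e _ _ _ _.
by rewrite !pevalZ !peval1 subrr normr0 mul0r.
Qed.

Lemma lipschitz_poly p : lipschitz_on_cube p.
Proof.
rewrite [p]mpolyE; apply: (big_ind lipschitz_on_cube) => [||m _].
- by rewrite -(scale0r 1); exact: lipschitzC.
- exact: lipschitzD.
rewrite -[mpolyX _ _]mul1r scalerAl; apply: lipschitzM; first exact: lipschitzC.
rewrite mpolyXE_id; apply: (big_ind lipschitz_on_cube) => [||i _].
- by rewrite -(scale1r 1); exact: lipschitzC.
- exact: lipschitzM.
elim: (m i) => [|l IH]; first by rewrite expr0 -(scale1r 1); exact: lipschitzC.
rewrite exprS; apply: lipschitzM => //; exists 1 => // x y e _ _ xye _.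
by rewrite !peval_var mul1r.
Qed.

End Lipschitz.

(** * Approximation by corners of boxes *)

Section BranchPoints.
Context {R : realType} {d : nat} (c : R).
Hypothesis c_gt0 : 0 < c.

Definition corner_pt (s : seq bool) : 'rV[R]_d := \row_i corner c s i.

Lemma corner_pt_cube beta n : cube c (corner_pt (branch beta n)).
Proof.
move=> i; rewrite mxE.
have [/= h1 h2] := corner_branch c_gt0 beta i (leq0n n).
have w0 := width_ge0 c_gt0 n i.
by rewrite ler_norml; apply/andP; split; lra.
Qed.

Lemma branch_limit_cube beta : cube c (branch_limit c beta : 'rV[R]_d).
Proof.
move=> i; have /= /andP[h1 h2] := branch_limitP c_gt0 beta 0 i.
by rewrite ler_norml; apply/andP; split; lra.
Qed.

Definition mesh N : R := 2 * c / 2 ^+ N.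

Lemma mesh_gt0 N : 0 < mesh N.
Proof. by rewrite divr_gt0// mulr_gt0. Qed.

Lemma mesh_small (e : R) : 0 < e -> exists N, mesh N < e.
Proof.
move=> e0; pose N := (Num.truncn (2 * c / e)).+1; exists N.
rewrite /mesh ltr_pdivrMr// [ltRHS]mulrC -ltr_pdivrMr//.
rewrite (lt_le_trans (truncnS_gt _))// -/N -natrX ler_nat ltnW//.
exact: ltn_expl.
Qed.

Lemma branch_limit_dist beta N i :
  `|(branch_limit c beta : 'rV[R]_d) ord0 i -
    corner_pt (branch beta (N * d)) ord0 i| <= mesh N.
Proof.
have /andP[h1 h2] := branch_limitP c_gt0 beta (N * d) i.
rewrite [X in _ - X]mxE [leLHS]ger0_norm ?subr_ge0// lerBlDl (le_trans h2)//.
by rewrite width_round.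
Qed.

Lemma code_dist x N i : cube c x ->
  `|x ord0 i - corner_pt (code c x (N * d)) ord0 i| <= mesh N.
Proof.
move=> cx; have /andP[h1 h2] := code_cell (N * d) i cx.
rewrite mxE ger0_norm ?subr_ge0// lerBlDl (le_trans h2)//.
by rewrite width_round.
Qed.

End BranchPoints.

(** * Borel sets of the space of row vectors *)

Section BorelSpace.
Context {R : realType} {d : nat}.

Lemma open_measurable_rV (U : set 'rV[R]_d) : open U ->
  measurable (U : set (borelRd R d)).
Proof. exact: sub_sigma_algebra. Qed.

Lemma closed_measurable_rV (A : set 'rV[R]_d) : closed A ->
  measurable (A : set (borelRd R d)).
Proof.
move=> cA; rewrite -[A]setCK; apply: (@measurableC _ (borelRd R d)).
by apply: open_measurable_rV; exact: closed_openC.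
Qed.

Lemma compact_measurable_rV (A : set 'rV[R]_d) : compact A ->
  measurable (A : set (borelRd R d)).
Proof.
by move=> cA; apply: closed_measurable_rV; exact: compact_closed.
Qed.

Lemma measurable_continuous_rV (f : 'rV[R]_d -> R) : continuous f ->
  measurable_fun [set: borelRd R d] f.
Proof.
move=> /continuousP cf; apply: (measurability _ (RGenOpens.measurableE R)).
move=> _ [_ [a [b ->] <-]]; rewrite setTI.
by apply: open_measurable_rV; apply: cf; exact: interval_open.
Qed.

End BorelSpace.

(** * The map from the line to the cube *)

Section BranchLimitMeasurable.
Context {R : realType} {d : nat} (c : R) (nu : seq bool -> R).
Hypothesis c_gt0 : 0 < c.

Definition limit_point (w : R) : 'rV[R]_d := branch_limit c (address nu w).

Lemma measurable_address_pred n (P : seq bool -> Prop) :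
  measurable [set w : R | P (branch (address nu w) n)].
Proof.
have := @measurable_address R nu n (fun s => (`[< P s >])%:R) measurableT [set 1].
rewrite setTI => /(_ (measurable_set1 _)); congr measurable.
apply/seteqP; split => w /=.
  by case: asboolP => //= _ /eqP; rewrite eq_sym oner_eq0.
by move=> Pw; rewrite asboolT.
Qed.

(** The point of [w] is in the open set [U] exactly when, for some [N], the ball
    of radius 2 * mesh N around the corner of its N-th box is contained in [U];
    this depends only on finitely many digits of the address of [w]. *)
Lemma measurable_limit_point :
  measurable_fun setT (limit_point : R -> borelRd R d).
Proof.
refine (@measurability _ _ _ (borelRd R d) setT limit_point (@open 'rV[R]_d)
  erefl _) => _ [U oU <-]; rewrite setTI.
pose near_in N s := (ball (corner_pt c s) (2 * mesh c N) : set 'rV[R]_d) `<=` U.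
rewrite (_ : _ @^-1` U =
    \bigcup_N [set w | near_in N (branch (address nu w) (N * d))]).
  apply: bigcupT_measurable => N.
  exact: (measurable_address_pred (N * d) (near_in N)).
have near_limit N w : ball (corner_pt c (branch (address nu w) (N * d)))
    (2 * mesh c N) (limit_point w).
  have m0 := mesh_gt0 c_gt0 N.
  split; first by rewrite mulr_gt0.
  move=> i j; rewrite (ord1 i) /ball /= distrC.
  rewrite (le_lt_trans (branch_limit_dist c_gt0 (address nu w) N j))//; lra.
apply/seteqP; split => w /=; last by move=> [N _]; apply; exact: near_limit.
move=> Uw; have /nbhs_ballP[e /= e0 eU] : nbhs (limit_point w) U.
  exact: open_nbhs_nbhs.
have [|N Ne] := @mesh_small R c (e / 4); first by rewrite divr_gt0.
exists N => // y /= [_ yN]; apply: eU; split => // i j.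
have m0 := mesh_gt0 c_gt0 N.
have := yN i j; have := branch_limit_dist c_gt0 (address nu w) N j.
rewrite (ord1 i) /ball /= -/(limit_point w) => h1 h2.
rewrite -(subrKA (corner_pt c (branch (address nu w) (N * d)) ord0 j)).
rewrite (le_lt_trans (ler_normD _ _))//; lra.
Qed.

Lemma measurable_limit_coord i : measurable_fun setT (fun w => limit_point w ord0 i).
Proof.
have mc : measurable_fun [set: borelRd R d] (fun x : 'rV[R]_d => x ord0 i).
  by apply: measurable_continuous_rV; exact: coord_continuous.
exact: measurableT_comp mc measurable_limit_point.
Qed.

End BranchLimitMeasurable.

(** * Limits along an ultrafilter *)

Section UltraLimit.
Context {R : realType} {U : set_system nat} {UU : UltraFilter U}.

Lemma ultra_fmap (T : Type) (z : nat -> T) : UltraFilter (fmap z U).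
Proof.
split; first exact: fmap_proper_filter.
move=> G GF UG; apply/seteqP; split; last exact: UG.
move=> A GA; have [//|UA] := in_ultra_setVsetC (z @^-1` A) UU.
have GnA : G (~` A) by exact: UG.
have : G (A `&` ~` A) by exact: filterI.
by rewrite setICr => /filter_not_empty.
Qed.

(** All the box masses converge along one and the same ultrafilter, which spares
    the extraction of a diagonal subsequence. *)
Lemma ultra_bounded_cvg (z : nat -> R) (M : R) :
  U [set n | `|z n| <= M] -> exists l : R, z @ U --> l.
Proof.
move=> zM; have := @segment_compact R (- M) M; rewrite compact_ultra.
move=> /(_ (fmap z U) (ultra_fmap z)) []; last by move=> l [_ zl]; exists l.
suff : U (z @^-1` `[- M, M]%classic) by [].
by apply: filterS zM => n /=; rewrite in_itv/= ler_norml.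
Qed.

End UltraLimit.

(** * Grid masses and their limit *)

Section DiscreteMasses.
Context {R : realType} {d : nat} (c : R) (L : {scalar mpoly d R}).
Hypothesis c_gt0 : 0 < c.
Hypothesis L_ge0 : forall n (a : {ffun 'I_d -> 'I_n.+1}), 0 <= L (cube_bern c a).

Definition bern_mass n : R := \sum_(a : {ffun 'I_d -> 'I_n.+1}) L (cube_bern c a).

Definition code_mass n (s : seq bool) : R := \sum_(a : {ffun 'I_d -> 'I_n.+1})
  L (cube_bern c a) * (code c (grid_point c a) (size s) == s)%:R.

Lemma code_mass_ge0 n s : 0 <= code_mass n s.
Proof. by apply: sumr_ge0 => a _; rewrite mulr_ge0. Qed.

Lemma code_mass_le n s : code_mass n s <= bern_mass n.
Proof. by apply: ler_sum => a _; case: eqP; rewrite ?mulr1 ?mulr0. Qed.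

Lemma code_split (x : 'rV[R]_d) s : (code c x (size s) == s)%:R =
  (code c x (size (false :: s)) == false :: s)%:R +
  (code c x (size (true :: s)) == true :: s)%:R :> R.
Proof.
rewrite /= !eqseq_cons; case: (_ == s); last by rewrite !andbF addr0.
by rewrite !andbT; case: [forall _, _]; rewrite ?add0r ?addr0.
Qed.

Lemma code_mass_split n s :
  code_mass n s = code_mass n (false :: s) + code_mass n (true :: s).
Proof.
rewrite /code_mass -big_split; apply: eq_bigr => a _ /=.
by rewrite -mulrDr -code_split.
Qed.

Lemma tree_sum_code_mass n (F : seq bool -> R) m t :
  tree_sum (code_mass n) F m t = \sum_(a : {ffun 'I_d -> 'I_n.+1})
    L (cube_bern c a) * ((code c (grid_point c a) (size t) == t)%:R *
      F (code c (grid_point c a) (size t + m))).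
Proof.
elim: m t => [|m IH] t.
  rewrite addn0 /= mulr_sumr; apply: eq_bigr => a _.
  by case: eqP => [->|_]; rewrite ?mulr1 ?mul1r ?mul0r ?mulr0// mulrC.
rewrite /= !IH -big_split; apply: eq_bigr => a _ /=.
rewrite code_split mulrDl mulrDr addnS; congr (_ + _).
Qed.

(** For large n, the Bernstein coefficients of the polynomial 1 are at least
    1 / 2. *)
Lemma bern_mass_bound : exists N, forall n, (N <= n)%N -> bern_mass n <= 2 * L 1.
Proof.
have e0 : 0 < 2^-1 :> R by rewrite invr_gt0.
have [N NP] := cube_bernP (1 : mpoly d R) c_gt0 e0.
exists N => n /NP[b bE b1].
rewrite bE linear_sum /= mulr_sumr; apply: ler_sum => a _.
rewrite linearZ /= mulrA -[leLHS]mul1r ler_wpM2r//.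
have := b1 a; rewrite peval1 ler_norml => /andP[h _]; lra.
Qed.

Lemma L1_ge0 : 0 <= L 1.
Proof.
have [N NP] := bern_mass_bound; have := NP N (leqnn N).
have : 0 <= bern_mass N by exact: sumr_ge0.
lra.
Qed.

Lemma bern_sum_cvg p :
  \sum_(a : {ffun 'I_d -> 'I_n.+1}) L (cube_bern c a) * peval p (grid_point c a)
    @[n --> \oo] --> L p.
Proof.
apply/cvgrPdist_le => e e0.
have L10 := L1_ge0; have e'0 : 0 < e / (2 * L 1 + 1).
  by rewrite divr_gt0// ltr_wpDl// mulr_ge0.
have [N NP] := cube_bernP p c_gt0 e'0.
have [M MP] := bern_mass_bound.
exists (maxn N M) => // n /=; rewrite geq_max => /andP[/NP[b pE bP] /MP Mn].
rewrite [in L p]pE linear_sum -sumrB (le_trans (ler_norm_sum _ _ _))//.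
rewrite (@le_trans _ _ (e / (2 * L 1 + 1) * bern_mass n))//.
  rewrite mulr_sumr; apply: ler_sum => a _; rewrite linearZ /= mulrC -mulrBr normrM.
  by rewrite (ger0_norm (L_ge0 _)) mulrC ler_wpM2r.
rewrite mulrAC ler_pdivrMr; last by rewrite ltr_wpDl// mulr_ge0.
by rewrite ler_wpM2l ?ltW// (le_lt_trans Mn)// ltrDl.
Qed.

(** Grid points with the same code of length N * d are within the mesh of the
    corner of their box. So replacing them by this corner changes the weighted
    sums of [p] by at most a constant times the mesh, uniformly in the degree,
    and the bound survives in the limit. *)
Lemma exists_limit_mass : exists nu : seq bool -> R,
  [/\ forall s, 0 <= nu s,
      forall s, nu s = nu (false :: s) + nu (true :: s) &
      forall p, exists2 K : R, 0 <= K & forall N,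
        `|L p - tree_sum nu (fun s => peval p (corner_pt c s)) (N * d) [::]|
          <= K * mesh c N].
Proof.
have [U [UU ooU]] := @ultraFilterLemma _ (\oo : set_system nat) _.
have [M MP] := bern_mass_bound.
have UM : U [set n | bern_mass n <= 2 * L 1] by apply: ooU; exists M.
have /choice[nu nuP] s : exists l : R, code_mass n s @[n --> U] --> l.
  apply: (@ultra_bounded_cvg _ _ _ _ (2 * L 1)); apply: filterS UM => n /=.
  by apply: le_trans; rewrite ger0_norm ?code_mass_ge0// code_mass_le.
have nuE s l : code_mass n s @[n --> U] --> l -> nu s = l.
  by move=> h; apply: (cvg_unique _ (nuP s) h); exact: norm_hausdorff.
have treeP F m t : tree_sum (code_mass n) F m t @[n --> U] --> tree_sum nu F m t.
  elim: m t => [|m IH] t /=; first exact: cvgMr.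
  exact: cvgD.
exists nu; split => [s|s|p].
- by apply: cvgr_to_ge (nuP s) _; apply: nearW => n; exact: code_mass_ge0.
- by apply: nuE; under eq_fun do rewrite code_mass_split; exact: cvgD.
have [K K0 pK] := lipschitz_poly c p.
exists (K * (2 * L 1)); first by rewrite mulr_ge0// mulr_ge0// L1_ge0.
move=> N; set F := fun s => _.
have h1 : \sum_(a : {ffun 'I_d -> 'I_n.+1}) L (cube_bern c a) *
    peval p (grid_point c a) @[n --> U] --> L p by move=> A /bern_sum_cvg; exact: ooU.
have h2 : `|\sum_(a : {ffun 'I_d -> 'I_n.+1}) L (cube_bern c a) *
        peval p (grid_point c a) - tree_sum (code_mass n) F (N * d) [::]| @[n --> U] -->
    `|L p - tree_sum nu F (N * d) [::]|.
  by apply: cvg_norm; apply: cvgB.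
apply: (cvgr_to_le h2); apply: filterS UM => n /= Wn.
have m0 := mesh_gt0 c_gt0 N.
rewrite tree_sum_code_mass -sumrB (le_trans (ler_norm_sum _ _ _))//.
rewrite (@le_trans _ _ (\sum_(a : {ffun 'I_d -> 'I_n.+1})
  L (cube_bern c a) * (K * mesh c N)))//.
  apply: ler_sum => a _; rewrite /= mul1r add0n -mulrBr normrM.
  rewrite (ger0_norm (L_ge0 _)) ler_wpM2l//; apply: pK => //.
  - exact: grid_point_cube.
  - exact: corner_pt_cube.
  - by move=> i; apply: code_dist => //; exact: grid_point_cube.
  - exact: ltW.
rewrite -mulr_suml -/(bern_mass n).
rewrite (_ : K * _ * _ = 2 * L 1 * (K * mesh c N)); last by ring.
by rewrite ler_wpM2r// mulr_ge0// ltW.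
Qed.

End DiscreteMasses.

(** * Lusin's theorem for maps into row vectors *)

Section InnerRegularity.
Context {R : realType} {d : nat}.
Local Notation leb := (@lebesgue_measure R).

Lemma continuous_within_rV (K : set R) (Y : R -> 'rV[R]_d) :
  (forall i, {within K, continuous (fun w => Y w ord0 i)}) ->
  {within K, continuous Y}.
Proof.
move=> cY w; apply/cvg_ballP => e e0.
have : \forall w' \near nbhs (w : subspace K), forall i : 'I_d,
    ball (Y w ord0 i) e (Y w' ord0 i).
  by apply: filter_forall => i; have /cvg_ballP := cY i w; exact.
by apply: filterS => w' Yw; split => // i j; rewrite (ord1 i).
Qed.

(** Lusin's theorem is applied to one coordinate after the other, each time on
    the compact set left by the previous ones. *)
Lemma lusin_rV (Y : R -> 'rV[R]_d) (E : set R) (e : R) :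
  (forall i, measurable_fun setT (fun w => Y w ord0 i)) ->
  measurable E -> (leb E < +oo)%E -> 0 < e ->
  exists K, [/\ compact K, K `<=` E, (leb (E `\` K) < e%:E)%E &
    {within K, continuous Y}].
Proof.
move=> mY mE finE e0.
suff [K [cK KE lK cY]] : exists K,
    [/\ compact K, K `<=` E, (leb (E `\` K) < e%:E)%E & forall i,
      i \in enum 'I_d -> {within K, continuous (fun w => Y w ord0 i)}].
  exists K; split => //; apply: continuous_within_rV => i.
  by apply: cY; rewrite mem_enum.
elim: (enum 'I_d) e e0 => [|i r IH] e e0.
  by have [K [cK KE lK]] := lebesgue_regularity_inner mE finE e0; exists K; split.
have e20 : 0 < e / 2 by rewrite divr_gt0.
have [K [cK KE lK cY]] := IH _ e20.
have mK : measurable K by exact: compact_measurable.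
have finK : (leb K < +oo)%E.
  by apply: le_lt_trans finE; apply: le_measure; rewrite ?inE.
have [K' [cK' KK' lK' cYi]] :=
  measurable_almost_continuous mK finK e20 (measurable_funTS (mY i)).
exists K'; split => //.
- exact: subset_trans KE.
- have mK' : measurable K' by exact: compact_measurable.
  apply: (@le_lt_trans _ _ (leb (E `\` K) + leb (K `\` K'))%E).
    apply: (@le_trans _ _ (leb ((E `\` K) `|` (K `\` K')))).
      apply: le_measure; rewrite ?inE; [exact: measurableD| |].
        by apply: measurableU; exact: measurableD.
      move=> w [Ew K'w]; have [Kw|Kw] := pselect (K w); [by right|by left].
    by apply: measureU2; exact: measurableD.
  by rewrite [e]splitr EFinD lteD.
move=> j; rewrite inE => /orP[/eqP ->//|jr].
exact: continuous_subspaceW KK' (cY _ jr).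
Qed.

End InnerRegularity.

(** * The limit measure *)

Section LimitLaw.
Context {R : realType} {d : nat} (c : R) (nu : seq bool -> R).
Hypothesis c_gt0 : 0 < c.
Hypothesis nu_ge0 : forall s, 0 <= nu s.
Hypothesis nu_split : forall s, nu s = nu (false :: s) + nu (true :: s).
Local Notation leb := (@lebesgue_measure R).
Local Notation Y := (@limit_point R d c nu).
Local Notation mY := (@measurable_limit_point R d c nu c_gt0).

Definition cell_lebesgue : {measure set (measurableTypeR R) -> \bar R} :=
  mrestr leb (measurable_cell nu [::]).

(** The image under the coding map of Lebesgue measure on the interval of the
    root. *)
Definition limit_law : {measure set (borelRd R d) -> \bar R} :=
  measure_function_pushforward__canonical__measure_function_Measure
    cell_lebesgue mY.

Lemma limit_lawE (A : set 'rV[R]_d) : limit_law A = leb (Y @^-1` A `&` cell nu [::]).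
Proof. by []. Qed.

Lemma measurable_preimage_limit (A : set (borelRd R d)) : measurable A ->
  measurable (Y @^-1` A `&` cell nu [::] : set R).
Proof.
move=> mA; apply: measurableI; last exact: measurable_cell.
by rewrite -[X in measurable X]setTI; exact: mY.
Qed.

Lemma lebesgue_preimage_fin (A : set (borelRd R d)) : measurable A ->
  (leb (Y @^-1` A `&` cell nu [::]) < +oo)%E.
Proof.
move=> mA; apply: (@le_lt_trans _ _ (leb (cell nu [::]))).
  apply: le_measure; rewrite ?inE.
  - exact: measurable_preimage_limit.
  - exact: measurable_cell.
  - exact: subIsetr.
by rewrite [X in (X < _)%E](lebesgue_cell nu_ge0) ltry.
Qed.

(** A compact set inside the preimage of [B] on which the coding map is
    continuous has a compact image inside [B], with at least the same mass. *)
Lemma limit_law_radon : radon limit_law.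
Proof.
split => [A cA|B mB].
  by rewrite limit_lawE; apply: lebesgue_preimage_fin; exact: compact_measurable_rV.
apply/eqP; rewrite eq_le; apply/andP; split; last first.
  apply: ge_ereal_sup => _ [A [cA AB] <-]; apply: le_measure => //.
  by rewrite inE; exact: compact_measurable_rV.
  by rewrite inE.
apply/lee_addgt0Pr => e e0; rewrite limit_lawE.
have [K [cK KE lK cY]] := @lusin_rV R d Y _ e (measurable_limit_coord nu c_gt0)
  (measurable_preimage_limit mB) (lebesgue_preimage_fin mB) e0.
have cYK : compact (Y @` K) by exact: continuous_compact.
have mK : measurable K by exact: compact_measurable.
set E := _ `&` _ in KE lK *.
have -> : E = K `|` (E `\` K) by rewrite setDUK.
rewrite (le_trans (measureU2 _ _ _))//.
  by apply: measurableD => //; exact: measurable_preimage_limit.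
rewrite leeD ?(ltW lK)//.
apply: (@le_trans _ _ (limit_law (Y @` K))).
  rewrite limit_lawE; apply: le_measure; rewrite ?inE//.
    by apply: measurable_preimage_limit; exact: compact_measurable_rV.
  by move=> w Kw; split; [exists w|have [] := KE _ Kw].
apply: ereal_sup_ubound; exists (Y @` K) => //; split => //.
by move=> _ [w Kw <-]; have [] := KE _ Kw.
Qed.

Lemma limit_law_cube : limit_law (~` cube c) = 0%E.
Proof.
rewrite limit_lawE (_ : _ @^-1` _ = set0) ?set0I ?measure0//.
apply/seteqP; split => w //=; apply; exact: branch_limit_cube.
Qed.

Lemma measurable_peval p : measurable_fun [set: borelRd R d] (peval p).
Proof. by apply: measurable_continuous_rV; exact: peval_continuous. Qed.

Lemma measurable_peval_limit p : measurable_fun setT (fun w : R => peval p (Y w)).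
Proof. exact: measurableT_comp (measurable_peval p) mY. Qed.

Lemma peval_limit_bounded p (A : set R) : [bounded peval p (Y w) | w in A].
Proof.
have [B B0 pB] := peval_norm_bound c p.
exists B; split; first exact: num_real.
move=> y By w _ /=; rewrite (le_trans _ (ltW By))// pB//.
exact: branch_limit_cube.
Qed.

Lemma integrable_peval_cell p :
  leb.-integrable (cell nu [::]) (EFin \o (fun w => peval p (Y w))).
Proof.
apply: measurable_bounded_integrable; first exact: measurable_cell.
- by rewrite [X in (X < _)%E](lebesgue_cell nu_ge0) ltry.
- by apply: measurable_funTS; exact: measurable_peval_limit.
- exact: peval_limit_bounded.
Qed.

Lemma integrable_peval_limit p :
  cell_lebesgue.-integrable setT (EFin \o (fun w => peval p (Y w))).
Proof.
apply: measurable_bounded_integrable => //.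
- rewrite /= /mrestr setTI [X in (X < _)%E](lebesgue_cell nu_ge0); exact: ltry.
- exact: measurable_peval_limit.
- exact: peval_limit_bounded.
Qed.

Lemma integrable_limit_law p :
  limit_law.-integrable [set: borelRd R d] (fun x => (peval p x)%:E).
Proof.
apply: (@integrable_pushforward _ _ (measurableTypeR R) (borelRd R d) R Y mY
  cell_lebesgue) => //.
  by apply/measurable_EFinP; exact: measurable_peval.
rewrite preimage_setT; exact: integrable_peval_limit.
Qed.

Lemma integral_limit_law p :
  (\int[limit_law]_(x in [set: borelRd R d]) (peval p x)%:E)%E =
  (\int[leb]_(w in cell nu [::]) (peval p (Y w)))%:E.
Proof.
rewrite (@integral_pushforward _ _ (measurableTypeR R) (borelRd R d) R Y mY
  cell_lebesgue)//; last 2 first.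
- by apply/measurable_EFinP; exact: measurable_peval.
- rewrite preimage_setT; exact: integrable_peval_limit.
rewrite preimage_setT (@negligible_integral _ (measurableTypeR R) R cell_lebesgue
  setT (~` cell nu [::])); last 4 first.
- by apply: measurableC; exact: measurable_cell.
- exact: measurableT.
- exact: integrable_peval_limit.
- by rewrite /= /mrestr setICl measure0.
rewrite setTD setCK (eq_measure_integral leb); last first.
  by move=> A mA Acell; rewrite /= /mrestr setIidl.
rewrite /Rintegral fineK//; apply: integrable_fin_num.
  exact: measurable_cell.
exact: integrable_peval_cell.
Qed.

(** Truncating the address of [w] after N * d digits moves its image by at most
    the mesh, and the integral of the truncated function is a [tree_sum]. *)
Lemma Rintegral_limit_dist p : exists2 K : R, 0 <= K & forall N,
  `|\int[leb]_(w in cell nu [::]) (peval p (Y w)) -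
    tree_sum nu (fun s => peval p (corner_pt c s)) (N * d) [::]| <= K * mesh c N.
Proof.
have [K K0 pK] := lipschitz_poly c p.
exists (K * nu [::]); first exact: mulr_ge0.
move=> N; rewrite -(Rintegral_address nu_ge0 nu_split) add0n.
have int1 := integrable_peval_cell p.
have int2 := integrable_address nu_ge0 (N * d)
  (fun s => peval p (corner_pt c s : 'rV[R]_d)) [::].
have int12 : leb.-integrable (cell nu [::]) (EFin \o (fun w => peval p (Y w) -
    peval p (corner_pt c (branch (address nu w) (N * d)) : 'rV[R]_d))).
  exact: (@integrableB _ (measurableTypeR R) R leb _ (measurable_cell nu [::])
    _ _ int1 int2).
rewrite -RintegralB//; last exact: measurable_cell.
rewrite (le_trans (le_normr_Rintegral _ int12))//; first exact: measurable_cell.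
rewrite mulrAC.
have <- : (\int[leb]_(w in cell nu [::]) (K * mesh c N))%R = K * mesh c N * nu [::].
  rewrite Rintegral_cst; last exact: measurable_cell.
  by rewrite [X in fine X](lebesgue_cell nu_ge0).
apply: le_Rintegral; first exact: measurable_cell.
- exact: integrable_norm int12.
- apply: measurable_bounded_integrable; first exact: measurable_cell.
  + by rewrite [X in (X < _)%E](lebesgue_cell nu_ge0) ltry.
  + exact: measurable_cst.
  + exists (K * mesh c N); split; first exact: num_real.
    move=> y Ky w _ /=; rewrite ger0_norm; first exact: ltW.
    by rewrite mulr_ge0// ltW// mesh_gt0.
move=> w _; apply: pK.
- exact: branch_limit_cube.
- exact: corner_pt_cube.
- by move=> i; apply: branch_limit_dist.
- by rewrite ltW// mesh_gt0.
Qed.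

End LimitLaw.

(** * Moment functionals on the cube *)

Section CubeMoments.
Context {R : realType} {d : nat} (c : R) (L : {scalar mpoly d R}).
Hypothesis c_gt0 : 0 < c.
Hypothesis L_ge0 : forall n (a : {ffun 'I_d -> 'I_n.+1}), 0 <= L (cube_bern c a).

(** The value [L p] and the integral of [p] are both within a multiple of the
    mesh of the same [tree_sum]. *)
Lemma moment_functional_cube : moment_functional (cube c) L.
Proof.
have [nu [nu0 nuS nuL]] := exists_limit_mass c_gt0 L_ge0.
exists (@limit_law R d c nu c_gt0); split.
- exact: limit_law_radon.
- exact: limit_law_cube.
- by move=> p; exact: integrable_limit_law.
move=> p; rewrite integral_limit_law//; congr (_%:E).
have [K1 K10 K1P] := nuL p.
have [K2 K20 K2P] := Rintegral_limit_dist c_gt0 nu0 nuS p.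
apply/eqP; rewrite -subr_eq0 -normr_le0; apply/ler_addgt0Pr => e e0.
have [|N Ne] := @mesh_small R c (e / (K1 + K2 + 1)).
  by rewrite divr_gt0// ltr_wpDl// addr_ge0.
rewrite add0r; move: (K1P N) (K2P N).
set I := Rintegral _ _ _; set S := tree_sum _ _ _ _ => h1 h2.
rewrite (_ : L p - I = (L p - S) - (I - S)); last by ring.
rewrite (le_trans (ler_normB _ _))// (le_trans (lerD h1 h2))//.
rewrite -mulrDl (@le_trans _ _ ((K1 + K2 + 1) * mesh c N))//.
  by rewrite ler_wpM2r ?lerDl// ltW// mesh_gt0.
by rewrite mulrC -ler_pdivlMr ?ltW// ltr_wpDl// addr_ge0.
Qed.

End CubeMoments.

(** * Support of a representing measure *)

Section Support.
Context {R : realType} {d : nat} (c : R) (K : set 'rV[R]_d).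
Context (L : {scalar mpoly d R}).
Context (mu : {measure set (borelRd R d) -> \bar R}).
Hypothesis K_cube : K `<=` cube c.
Hypothesis L_ge0 : forall p, (forall x, K x -> 0 <= peval p x) -> 0 <= L p.
Hypothesis mu_cube : mu (~` cube c) = 0%E.
Hypothesis mu_int : forall p : mpoly d R,
  mu.-integrable [set: borelRd R d] (fun x => (peval p x)%:E).
Hypothesis mu_L : forall p : mpoly d R,
  (L p)%:E = (\int[mu]_(x in [set: borelRd R d]) (peval p x)%:E)%E.

Lemma measurable_cube : measurable (cube c : set (borelRd R d)).
Proof. by apply: compact_measurable_rV; exact: cube_compact. Qed.

Lemma measurable_cube_sublevel q (e : R) :
  measurable (cube c `&` [set x | peval q x <= e] : set (borelRd R d)).
Proof.
apply: (@measurableI _ (borelRd R d)); first exact: measurable_cube.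
apply: closed_measurable_rV.
have /continuous_closedP := @peval_continuous R d q.
by move=> /(_ _ (@closed_le R e)).
Qed.

(** The polynomial q (1 - q) ^ n is nonnegative on [K], hence so is its integral.
    It is at most 1 on the cube and at most - n e ^ 2 on the sublevel set, so
    n e ^ 2 times the mass of this set stays below [L 1] for all [n]. *)
Lemma sublevel_null q (e : R) : 0 < e ->
  (forall x, K x -> 0 <= peval q x) -> (forall x, cube c x -> peval q x <= 1) ->
  mu (cube c `&` [set x | peval q x <= - e]) = 0%E.
Proof.
move=> e0 qK q1; set A := _ `&` _.
have mA : measurable (A : set (borelRd R d)) by exact: measurable_cube_sublevel.
have bound n : ((n%:R * (e * e))%:E * mu A <= (L 1)%:E)%E.
  pose p : mpoly d R := 1 - q * (1 - q) ^+ n.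
  have pE x : peval p x = 1 - peval q x * (1 - peval q x) ^+ n.
    by rewrite pevalB peval1 pevalM pevalX pevalB peval1.
  have p0 x : cube c x -> 0 <= peval p x.
    move=> /q1 qx; rewrite pE subr_ge0 (le_trans (mul_expr_onem_le _ qx))//.
    by rewrite invf_le1// ler1n.
  apply: (@le_trans _ _ (L p)%:E); last first.
    rewrite lee_fin /p linearB /= lerBlDr lerDl; apply: L_ge0 => x Kx.
    rewrite pevalM pevalX pevalB peval1 mulr_ge0 ?qK// exprn_ge0// subr_ge0.
    by apply: q1; exact: K_cube.
  rewrite mu_L.
  rewrite (@negligible_integral _ (borelRd R d) R mu setT (~` cube c)) //; last first.
    by apply: (@measurableC _ (borelRd R d)); exact: measurable_cube.
  rewrite setTD setCK.
  have mp : measurable_fun [set: borelRd R d] (fun x => (peval p x)%:E).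
    by apply/measurable_EFinP; exact: measurable_peval.
  apply: (@le_trans _ _ (\int[mu]_(x in A) (peval p x)%:E)%E); last first.
    apply: ge0_subset_integral => //; first exact: measurable_cube.
    - exact: measurable_funTS.
    - exact: subIsetl.
  rewrite -integral_cst//; apply: ge0_le_integral => //.
  - by move=> x _; rewrite lee_fin mulr_ge0// mulr_ge0// ltW.
  - exact: measurable_funTS.
  move=> x [cx /= qe]; rewrite lee_fin pE.
  have eq : e <= - peval q x by rewrite lerNr.
  have h : 1 + n%:R * e <= (1 - peval q x) ^+ n.
    rewrite (le_trans (bernoulli_ineq _ (ltW e0)))// lerXn2r ?nnegrE ?lerD2l//.
      by rewrite addr_ge0// ltW.
    by rewrite addr_ge0// (le_trans (ltW e0)).
  have ne0 : 0 <= n%:R * e by rewrite mulr_ge0// ltW.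
  have h2 : e * (1 + n%:R * e) <= (- peval q x) * (1 - peval q x) ^+ n.
    by apply: ler_pM => //; [exact: ltW|rewrite addr_ge0].
  move: h2; rewrite mulNr; nra.
have mA0 : (0 <= mu A)%E by exact: measure_ge0.
case E : (mu A) bound mA0 => [r| |]//.
  rewrite lee_fin => bound r0; congr (_%:E); apply/eqP; rewrite eq_le r0 andbT.
  rewrite leNgt; apply/negP => rgt0.
  have eer : 0 < e * e * r by rewrite !mulr_gt0.
  have := bound (Num.truncn (L 1 / (e * e * r))).+1.
  rewrite -EFinM lee_fin -[_ * _ * r]mulrA -ler_pdivlMr//.
  by rewrite leNgt truncnS_gt.
by move=> /(_ 1%N); rewrite mul1r gt0_muley// lte_fin mulr_gt0.
Qed.

(** Scale [q] so that it is at most 1 on the cube, and exhaust the set where it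
    is negative by the sublevel sets of [sublevel_null]. *)
Lemma negative_null q : (forall x, K x -> 0 <= peval q x) ->
  mu.-negligible ([set x | peval q x < 0] : set (borelRd R d)).
Proof.
move=> qK.
have [C C0 qC] := peval_lt_bound q (@cube_compact R d c).
pose q' := C^-1 *: q.
have E x : peval q' x = C^-1 * peval q x by rewrite pevalZ.
have q'K x : K x -> 0 <= peval q' x.
  by move=> /qK qx; rewrite E mulr_ge0// invr_ge0 ltW.
have q'1 x : cube c x -> peval q' x <= 1.
  by move=> /qC qx; rewrite E mulrC ler_pdivrMr// mul1r ltW.
apply: (@negligibleS _ (borelRd R d) R mu
  (~` cube c `|` \bigcup_n (cube c `&` [set x | peval q' x <= - n.+1%:R^-1]))).
  move=> x /= qx; have [cx|cx] := pselect (cube c x); [right|by left].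
  have q'x : 0 < - peval q' x by rewrite E oppr_gt0 pmulr_rlt0// invr_gt0.
  exists (Num.truncn (- peval q' x)^-1) => //; split => //=.
  rewrite lerNr -[leRHS]invrK lef_pV2 ?posrE ?invr_gt0//.
  by rewrite ltW// truncnS_gt.
apply: negligibleU.
  apply/negligibleP => //; apply: (@measurableC _ (borelRd R d)).
  exact: measurable_cube.
apply: negligible_bigcup => n; apply/negligibleP; first exact: measurable_cube_sublevel.
by apply: sublevel_null.
Qed.

End Support.

(** * Moment functionals on K *)

Section MomentProblem.
Context {R : realType} {d k r : nat}.
Context (f : 'I_k -> mpoly d R) (g : 'I_r.+1 -> mpoly d R).
Hypothesis g0 : g ord0 = 1.
Hypothesis f_linear : forall i, degree_le1 (f i).
Hypothesis K_compact : compact (semialg f).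
Hypothesis K_nonempty : semialg f !=set0.
Local Notation K := (semialg f `&` semialg g).

Lemma closed_semialg m (p : 'I_m -> mpoly d R) : closed (semialg p).
Proof.
rewrite (_ : semialg p = \bigcap_(i in setT) (peval (p i) @^-1` [set y | 0 <= y])).
  apply: closed_bigI => i _.
  have /continuous_closedP := @peval_continuous R d (p i).
  by move=> /(_ _ (@closed_ge R 0)).
by apply/seteqP; split => x /= px; [move=> i _; exact: px|move=> i; exact: px].
Qed.

Lemma measurable_setC_semialg : measurable (~` K : set (borelRd R d)).
Proof.
apply: (@measurableC _ (borelRd R d)); apply: closed_measurable_rV.
by apply: closedI; exact: closed_semialg.
Qed.

Lemma moment_functional_ge0 (L : {scalar mpoly d R}) p :
  moment_functional K L -> (forall x, K x -> 0 <= peval p x) -> 0 <= L p.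
Proof.
move=> [mu [_ muK mu_int muL]] pK; rewrite -lee_fin muL.
have mK := measurable_setC_semialg.
rewrite (@negligible_integral _ (borelRd R d) R mu setT (~` K)) //.
by rewrite setTD setCK; apply: integral_ge0 => x Kx; rewrite lee_fin pK.
Qed.

Lemma peval_generator_ge0 j n x : K x -> 0 <= peval (g j * pprod f n) x.
Proof.
move=> [fx gx]; rewrite pevalM mulr_ge0 ?gx// peval_prod prodr_ge0// => i _.
by rewrite pevalX exprn_ge0.
Qed.

Section NonnegativeFunctional.
Variable L : {scalar mpoly d R}.
Hypothesis L_ge0 : forall j n, 0 <= L (g j * pprod f n).

Lemma moduleC_functional_ge0 p : moduleC f g p -> 0 <= L p.
Proof.
move=> [s [sS ->]]; rewrite linear_sum sumr_ge0// => j _.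
have [N [a [n [a0 ->]]]] := sS j.
rewrite mulr_sumr linear_sum sumr_ge0// => t _.
by rewrite -scalerAr linearZ mulr_ge0.
Qed.

Lemma semiringS_functional_ge0 p : semiringS f p -> 0 <= L p.
Proof.
move=> [N [a [n [a0 ->]]]]; rewrite linear_sum sumr_ge0// => t _.
by rewrite linearZ mulr_ge0// -[pprod _ _]mul1r -g0.
Qed.

(** Part (i) needs strict positivity, hence the limit of p + a for a > 0 tending
    to 0. *)
Lemma nonneg_functional_ge0 p : (forall x, K x -> 0 <= peval p x) -> 0 <= L p.
Proof.
move=> pK; have L1 : 0 <= L 1 by apply: semiringS_functional_ge0; exact: semiringS1.
apply/ler_addgt0Pr => e e0; pose a := e / (L 1 + 1).
have a0 : 0 < a by rewrite divr_gt0// ltr_wpDl.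
have : 0 <= L (p + a *: 1).
  apply: moduleC_functional_ge0; apply: pos_moduleC => // x Kx.
  by rewrite pevalD pevalZ peval1 mulr1 ltr_wpDl// pK.
rewrite linearD linearZ /= => h; rewrite (le_trans h)// lerD2l /a mulrAC.
rewrite ler_pdivrMr; last by rewrite ltr_wpDl.
by rewrite ler_wpM2l ?ltW// ltrDl.
Qed.

Lemma nonneg_moment_functional : moment_functional K L.
Proof.
have [c c0 fc] := compact_semialg_sub_cube K_compact.
have Kc : K `<=` cube c by move=> x [/fc].
have [|mu [rad mu_cube mu_int mu_L]] := @moment_functional_cube R d c L c0.
  by move=> n a; apply: semiringS_functional_ge0; exact: cube_bern_semiringS.
exists mu; split => //.
(* All constraints in one sequence, padded with the positive constant 1. *)
pose q n := nth 1 (codom f ++ codom g) n.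
have qK n x : K x -> 0 <= peval (q n) x.
  move=> [fx gx]; rewrite /q; have [nlt|nge] := ltnP n (size (codom f ++ codom g)).
    have := mem_nth (1 : mpoly d R) nlt.
    by rewrite mem_cat => /orP[/codomP[i ->]|/codomP[i ->]].
  by rewrite nth_default// peval1.
have mK := measurable_setC_semialg.
apply/(@negligibleP _ (borelRd R d) R mu _ mK).
apply: (@negligibleS _ (borelRd R d) R mu
  (\bigcup_n [set x | peval (q n) x < 0])); last first.
  apply: negligible_bigcup => n.
  apply: (@negative_null R d c K L mu Kc _ mu_cube mu_int mu_L _ (qK n)) => p.
  exact: nonneg_functional_ge0.
move=> x Kx; apply: contrapT => nx; apply: Kx.
have q0 p : p \in codom f ++ codom g -> 0 <= peval p x.
  move=> ps; rewrite leNgt; apply/negP => px; apply: nx.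
  by exists (index p (codom f ++ codom g)) => //=; rewrite /q nth_index.
by split => i; apply: q0; rewrite mem_cat codom_f ?orbT.
Qed.

End NonnegativeFunctional.

End MomentProblem.

Theorem theorem12p59 (R : realType) (d k r : nat) (hk : (0 < k)%N)
    (f : 'I_k -> mpoly d R) (g : 'I_r.+1 -> mpoly d R)
    (g0 : g ord0 = 1)
    (f_linear : forall i, degree_le1 (f i))
    (K_compact : compact (semialg f))
    (K_nonempty : semialg f !=set0) :
  (forall h : mpoly d R,
     (forall x, (semialg f `&` semialg g) x -> 0 < peval h x) ->
     moduleC f g h) /\
  (forall L : {scalar mpoly d R},
     moment_functional (semialg f `&` semialg g) L <->
     (forall (j : 'I_r.+1) (n : 'I_k -> nat), 0 <= L (g j * pprod f n))).
Proof.
split=> [h|L]; first exact: pos_moduleC.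
split=> [LK j n|L_ge0].
  by apply: (moment_functional_ge0 LK) => x; exact: peval_generator_ge0.
exact: nonneg_moment_functional.
Qed.
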